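(* Let $\beta$ be a positive root and let $\beta=s_{i_r}\cdots s_{i_2}s_{i_1}\alpha_j$ be a positive expression for $\beta$. The bricks of dimension $\beta$ are precisely (up to isomorphism) the modules of the form $\Sigma^{\pm_r}_{i_r}\cdots\Sigma^{\pm_2}_{i_2}\Sigma^{\pm_1}_{i_1}S_j$, where the signs must be chosen such that the expression is well-defined.
   Context: Root system. Let $d_1,\dots,d_n$ be positive integers and let $A=(A_{ij})$ be an $n\times n$ integer matrix with $A_{ii}=2$, $d_iA_{ij}=d_jA_{ji}$, and $A_{ij}\le 0$ for $i\ne j$ (a crystallographic symmetrizable Cartan matrix). Let $V$ be the real vector space with basis $\alpha_1,\dots,\alpha_n$, with symmetric bilinear form $(\alpha_i,\alpha_j)=d_iA_{ij}$; put $\alpha_i^\vee=d_i^{-1}\alpha_i$ and $s_i(x)=x-(\alpha_i^\vee,x)\alpha_i$. Let $W\subset \mathrm{GL}(V)$ be generated by the $s_i$. The set of (real) roots is $\Phi=\{w\alpha_i: w\in W,\ 1\le i\le n\}$; every root is a nonnegative (positive root, $\Phi^+$) or nonpositive (negative root) combination of the $\alpha_i$. Positive expressions. A positive expression for a positive root $\beta$ is a formula $\beta=s_{i_r}\cdots s_{i_1}\alpha_j$ ($r\ge 0$) such that for all $1\le k\le r$, $s_{i_k}s_{i_{k-1}}\cdots s_{i_1}\alpha_j-s_{i_{k-1}}\cdots s_{i_1}\alpha_j\in\mathbb R_{>0}\alpha_{i_k}$. Preprojective algebra. Put $d_{ij}=\mathrm{LCM}(d_i,d_j)$, $L=\mathrm{LCM}(d_1,\dots,d_n)$.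 Let $\kappa(L)/\kappa$ be a Galois extension of fields with cyclic Galois group of order $L$, and for $d\mid L$ let $\kappa(d)$ be the unique subextension of degree $d$ over $\kappa$. Let $\Gamma$ be the quiver with vertices $1,\dots,n$ and, for $i\neq j$, $-d_iA_{ij}/d_{ij}$ arrows $i\to j$; fix a bijection $a\mapsto a^*$ between arrows $i\to j$ and arrows $j\to i$ with $(a^* )^*=a$. Let $E(j\leftarrow i)$ be the $\kappa(d_{ij})$-vector space with basis the arrows $i\to j$, regarded as a $\kappa(d_j)$-$\kappa(d_i)$-bimodule. The path algebra is the tensor algebra over $\prod_i\kappa(d_i)$ of the bimodule $\bigoplus_{i\ne j}E(j\leftarrow i)$. For $i\ne j$ let $(b^{ji}_k)_k$ be a $\kappa(d_j)$-basis of $\kappa(d_{ij})$ and $((b^{ji}_k)^* )_k$ the dual basis for the trace pairing $(b,b')\mapsto\mathrm{tr}_{\kappa(d_{ij})/\kappa(d_j)}(bb')$. Fix signs $\mathrm{sgn}(i,j)\in\{\pm1\}$ for $i\ne j$ with $\mathrm{sgn}(i,j)=-\mathrm{sgn}(j,i)$. The preprojective algebra $\Lambda$ is the quotient of the path algebra by the relations $\sum_{j\ne i}\mathrm{sgn}(i,j)\sum_{a:i\to j}\sum_k (b^{ji}_k)^*a^*\otimes a\,b^{ji}_k=0$ for $1\le i\le n$ (up to isomorphism independent of the choices). A $\Lambda$-module $M$ (left module) is a collection of $\kappa(d_i)$-vector spaces $M_i$ with $\kappa(d_j)$-linear maps $M_{j\leftarrow i}:E(j\leftarrow i)\otimes_{\kappa(d_i)}M_i\to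 M_j$ satisfying these relations; $M$ is finite dimensional if all $M_i$ are finite dimensional over $\kappa$, and then its dimension is $\dim M=\sum_i(\dim_{\kappa(d_i)}M_i)\alpha_i\in V$. $S_i$ is the module with $\kappa(d_i)$ at vertex $i$ and $0$ elsewhere. A brick is a nonzero finite dimensional $\Lambda$-module whose endomorphism ring is a division ring. Reflection functors. $\mathrm{NoSub}_i$ (resp. $\mathrm{NoQuot}_i$) is the full subcategory of finite dimensional $\Lambda$-modules not having $S_i$ as a submodule (resp. quotient). Put $M_{\partial i}=\bigoplus_{j\ne i}E(i\leftarrow j)\otimes_{\kappa(d_j)}M_j$; let $M_{i,\mathrm{in}}:M_{\partial i}\to M_i$ be $\mathrm{sgn}(i,j)M_{i\leftarrow j}$ on the $j$th summand, and $M_{i,\mathrm{out}}:M_i\to M_{\partial i}$ have $j$th component $m\mapsto\sum_{a:i\to j}\sum_k(b^{ji}_k)^*a^*\otimes M_{j\leftarrow i}(a\,b^{ji}_k\otimes m)$. The preprojective relations say $M_{i,\mathrm{in}}M_{i,\mathrm{out}}=0$; $M\in\mathrm{NoSub}_i$ iff $M_{i,\mathrm{out}}$ is injective, $M\in\mathrm{NoQuot}_i$ iff $M_{i,\mathrm{in}}$ is surjective. For $M\in\mathrm{NoQuot}_i$, $\Sigma_i(M)=\Sigma_i^+(M)$ is obtained from $M$ by replacing $M_i$ by $\mathrm{Ker}(M_{i,\mathrm{in}})$, with out-map the inclusion $\mathrm{Ker}(M_{i,\mathrm{in}})\hookrightarrow M_{\partial i}$ and in-map $M_{i,\mathrm{out}}M_{i,\mathrm{in}}:M_{\partial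 i}\to\mathrm{Ker}(M_{i,\mathrm{in}})$, all other data unchanged. For $M\in\mathrm{NoSub}_i$, $\Sigma_i^{-1}(M)=\Sigma_i^-(M)$ is obtained by replacing $M_i$ by $\mathrm{CoKer}(M_{i,\mathrm{out}})$, with in-map the quotient map from $M_{\partial i}$ and out-map $\mathrm{CoKer}(M_{i,\mathrm{out}})\to M_{\partial i}$ induced by $M_{i,\mathrm{out}}M_{i,\mathrm{in}}$, all other data unchanged. These are mutually inverse equivalences $\Sigma_i:\mathrm{NoQuot}_i\to\mathrm{NoSub}_i$ and $\Sigma_i^{-1}:\mathrm{NoSub}_i\to\mathrm{NoQuot}_i$; $\Sigma_i$ is only defined on $\mathrm{NoQuot}_i$ and $\Sigma_i^{-1}$ only on $\mathrm{NoSub}_i$. The expression $\Sigma^{\pm_r}_{i_r}\cdots\Sigma^{\pm_1}_{i_1}S_j$ is well-defined if for each $q$ the partial product $\Sigma^{\pm_{q-1}}_{i_{q-1}}\cdots\Sigma^{\pm_1}_{i_1}S_j$ lies in $\mathrm{NoQuot}_{i_q}$ when $\pm_q=+$, and in $\mathrm{NoSub}_{i_q}$ when $\pm_q=-$. *)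

(* Defs.v *)
From HB Require Import structures.
From mathcomp Require Import all_boot all_order all_fingroup all_algebra.
From mathcomp Require Import all_solvable all_field.
From mathcomp Require Import reals.

Set Implicit Arguments.
Unset Strict Implicit.
Unset Printing Implicit Defensive.

Import Order.TTheory GRing.Theory Num.Theory.
Local Open Scope ring_scope.

Record cartan (n : nat) := Cartan {
  cd : 'I_n -> nat;
  cA : 'M[int]_n;
  cd_gt0 : forall i, (0 < cd i)%N;
  cA_diag : forall i, cA i i = 2;
  cA_sym : forall i j, (cd i)%:Z * cA i j = (cd j)%:Z * cA j i;
  cA_le0 : forall i j, i != j -> cA i j <= 0 }.

Section RootSystem.
Variables (R : realType) (n : nat) (C : cartan n).
Local Notation V := 'rV[R]_n.
Local Notation d := (cd C).
Local Notation A := (cA C).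
Implicit Types (x y beta : V) (i j : 'I_n) (s : seq 'I_n).

Definition alpha i : V := delta_mx 0 i.

Definition form x y : R :=
  \sum_i \sum_j x 0 i * ((d i)%:R * (A i j)%:~R) * y 0 j.

Definition coroot i : V := (d i)%:R^-1 *: alpha i.

Definition sref i x : V := x - form (coroot i) x *: alpha i.

(* The subgroup of GL(V) generated by the reflections, its elements being seen
   as the underlying maps V -> V. *)
Inductive weyl : (V -> V) -> Prop :=
| weyl_id : weyl id
| weyl_sref i : weyl (sref i)
| weyl_comp w1 w2 : weyl w1 -> weyl w2 -> weyl (w1 \o w2)
| weyl_inv w w' : weyl w -> cancel w w' -> cancel w' w -> weyl w'.

Definition real_root beta := exists w i, weyl w /\ beta = w (alpha i).

Definition positive_root beta := real_root beta /\ forall i, 0 <= beta 0 i.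

(* For s = [:: i_1; ...; i_r] this is s_{i_r} ... s_{i_1} x. *)
Fixpoint reflect_along s x : V :=
  if s is i :: s' then reflect_along s' (sref i x) else x.

Fixpoint increasing_along s x : Prop :=
  if s is i :: s' then
    (exists2 c : R, 0 < c & sref i x - x = c *: alpha i)
    /\ increasing_along s' (sref i x)
  else True.

Definition positive_expression beta s j :=
  beta = reflect_along s (alpha j) /\ increasing_along s (alpha j).

End RootSystem.

Section Lcm.
Variables (n : nat) (C : cartan n).

Definition dd (i j : 'I_n) : nat := lcmn (cd C i) (cd C j).
Definition dL : nat := \big[lcmn/1%N]_(i < n) cd C i.

End Lcm.

(* All the choices made in the construction of the preprojective algebra.  The
   extension kappa(L)/kappa is KL/k0, and kap d is kappa(d) for d dividing L. *)
Record preproj_datum (n : nat) (C : cartan n) (k0 : fieldType)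
    (KL : splittingFieldType k0) := PreprojDatum {
  KL_galois : galois 1%AS {:KL};
  KL_cyclic : cyclic 'Gal({:KL} / 1%AS)%g;
  KL_order : #|'Gal({:KL} / 1%AS)%g| = dL C;
  kap : nat -> {subfield KL};
  kap_dim : forall e, (e %| dL C)%N -> \dim (kap e) = e;
  (* arrow i j is the set of arrows i -> j; there are no loops *)
  arrow : 'I_n -> 'I_n -> finType;
  arrow_loop : forall i, #|arrow i i| = 0%N;
  arrow_card : forall i j, i != j ->
    #|arrow i j|%:Z * (dd C i j)%:Z = - ((cd C i)%:Z * cA C i j);
  arrow_star : forall i j, arrow i j -> arrow j i;
  arrow_starK : forall i j (a : arrow i j), arrow_star (arrow_star a) = a;
  (* bas j i and dbas j i are the dual bases (b^{ji}_k) and ((b^{ji}_k)^* ) *)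
  bas : forall j i, (dd C j i %/ cd C j).-tuple KL;
  dbas : forall j i, (dd C j i %/ cd C j).-tuple KL;
  bas_basis : forall j i, i != j ->
    basis_of (vspaceOver (kap (cd C j)) (kap (dd C j i)))
             (bas j i : seq (fieldOver (kap (cd C j))));
  dbas_mem : forall j i, i != j -> forall k, tnth (dbas j i) k \in kap (dd C j i);
  dbas_dual : forall j i, i != j -> forall k l,
    galTrace (kap (cd C j)) (kap (dd C j i)) (tnth (bas j i) k * tnth (dbas j i) l)
    = (k == l)%:R;
  vsgn : 'I_n -> 'I_n -> int;
  vsgn_pm : forall i j, i != j -> vsgn i j = 1 \/ vsgn i j = -1;
  vsgn_anti : forall i j, i != j -> vsgn i j = - vsgn j i }.

Lemma kap_sub n (C : cartan n) k0 (KL : splittingFieldType k0)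
    (P : preproj_datum C KL) e f :
  (e %| f)%N -> (f %| dL C)%N -> (kap P e <= kap P f)%VS.
Proof.
move=> ef fL; have eL := dvdn_trans ef fL.
have galK (M : {subfield KL}) : galois M {:KL}.
  by apply: galoisS (KL_galois P); rewrite sub1v subvf.
have L_gt0 : (0 < dL C)%N by rewrite -(KL_order P) cardG_gt0.
have dimL : \dim {:KL} = dL C.
  by rewrite -(KL_order P) -(galois_dim (KL_galois P)) dimv1 divn1.
have card g : (g %| dL C)%N -> #|'Gal({:KL} / kap P g)%g| = (dL C %/ g)%N.
  by move=> gL; rewrite -galois_dim // dimL kap_dim.
rewrite -(galois_fixedField (galK (kap P e))) -(galois_fixedField (galK (kap P f))).
apply: fixedFieldS; have sG g := galS {:KL}%AS (sub1v (kap P g)).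
rewrite -(cardSg_cyclic (KL_cyclic P)) ?sG // !card //.
have e_gt0 := dvdn_gt0 L_gt0 eL; have f_gt0 := dvdn_gt0 L_gt0 fL.
case/dvdnP: fL => r ->; case/dvdnP: ef f_gt0 => q -> f_gt0.
by rewrite mulnK // mulnA mulnK // dvdn_mulr.
Qed.

Section Preprojective.
Variables (n : nat) (C : cartan n) (k0 : fieldType) (KL : splittingFieldType k0).
Variable P : preproj_datum C KL.
Implicit Types i j k l : 'I_n.

Definition Kv i : fieldType := subvs_of (kap P (cd C i)).

(* kappa(d_ij) as a vector space over kappa(d_j) *)
Definition Vij j i : {vspace fieldOver (kap P (cd C j))} :=
  vspaceOver (kap P (cd C j)) (kap P (dd C j i)).
Definition Kij j i : vectType (Kv j) := subvs_of (Vij j i).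

Definition toKij j i (x : KL) : Kij j i := vsproj (Vij j i) x.
Definition ofKij j i (x : Kij j i) : KL := vsval x.

(* E(j <- i), by the coefficients on the basis of arrows i -> j *)
Definition Ebim j i : vectType (Kv j) := {ffun arrow P i j -> Kij j i}.

(* a x, for an arrow a and x in kappa(d_ij) *)
Definition mono j i (a : arrow P i j) (x : KL) : Ebim j i :=
  [ffun a' => if a' == a then toKij j i x else 0].

Definition rscale j i (e : Ebim j i) (c : Kv i) : Ebim j i :=
  [ffun a => toKij j i (ofKij (e a) * vsval c)].

(* The tensor product of E(j <- i) and X over kappa(d_i), with its left
   kappa(d_j)-structure: as E(j <- i) is free over kappa(d_ij) on the arrows,
   it is the sum over the arrows of the extension of scalars of X to
   kappa(d_ij), given by coordinates in a basis of X.  The universal property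
   is [tens_balanced], [tlift_tens] and [tlift_unique]. *)
Definition tensor j i (X : vectType (Kv i)) : vectType (Kv j) :=
  {ffun arrow P i j * 'I_(\dim {:X}) -> Kij j i}.

Definition tens j i (X : vectType (Kv i)) (e : Ebim j i) (x : X) : tensor j X :=
  [ffun p => toKij j i (ofKij (e p.1) * vsval (coord (vbasis {:X}) p.2 x))].

(* The map on the tensor product induced by a balanced biadditive map. *)
Definition tlift j i (X : vectType (Kv i)) (Y : zmodType) (B : Ebim j i -> X -> Y)
    (t : tensor j X) : Y :=
  \sum_p B (mono p.1 (ofKij (t p))) (vbasis {:X})`_p.2.

Definition tmap j i (X X' : vectType (Kv i)) (f : 'Hom(X, X')) :
    tensor j X -> tensor j X' := tlift (fun e x => tens e (f x)).

Definition balanced j i (X : vectType (Kv i)) (Y : zmodType)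
    (B : Ebim j i -> X -> Y) :=
  [/\ forall e e' x, B (e + e') x = B e x + B e' x,
      forall e x x', B e (x + x') = B e x + B e x' &
      forall e c x, B (rscale e c) x = B e (c *: x)].

Lemma dd_dvd j i : (dd C j i %| dL C)%N.
Proof. by rewrite dvdn_lcm (biglcmn_sup j) ?(biglcmn_sup i). Qed.

Lemma K_sub_l j i : (kap P (cd C j) <= kap P (dd C j i))%VS.
Proof. by apply: kap_sub (dd_dvd j i); rewrite dvdn_lcml. Qed.

Lemma K_sub_r j i : (kap P (cd C i) <= kap P (dd C j i))%VS.
Proof. by apply: kap_sub (dd_dvd j i); rewrite dvdn_lcmr. Qed.

Lemma toKijK j i (x : KL) : x \in kap P (dd C j i) -> ofKij (toKij j i x) = x.
Proof.
by move=> xK; rewrite /ofKij /toKij vsprojK // mem_aspaceOver // K_sub_l.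
Qed.

Lemma ofKijK j i (x : Kij j i) : toKij j i (ofKij x) = x.
Proof. exact: vsvalK. Qed.

Lemma ofKij_mem j i (x : Kij j i) : ofKij x \in kap P (dd C j i).
Proof. by rewrite -(mem_aspaceOver (K_sub_l j i)) subvsP. Qed.

Lemma vsvalK_mem j i (c : Kv i) : vsval c \in kap P (dd C j i).
Proof. exact: (subvP (K_sub_r j i)) (subvsP c). Qed.

Lemma ofKijD j i (x y : Kij j i) : ofKij (x + y) = ofKij x + ofKij y.
Proof. exact: (@raddfD _ _ (@vsval _ _ (Vij j i))). Qed.

Lemma ofKij0 j i : ofKij (0 : Kij j i) = 0.
Proof. exact: (@raddf0 _ _ (@vsval _ _ (Vij j i))). Qed.

Lemma toKijD j i (x y : KL) : toKij j i (x + y) = toKij j i x + toKij j i y.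
Proof. exact: (@raddfD _ _ (@vsproj _ _ (Vij j i))). Qed.

Lemma toKij0 j i : toKij j i 0 = 0.
Proof. exact: (@raddf0 _ _ (@vsproj _ _ (Vij j i))). Qed.

Lemma ofKijZ j i (c : Kv j) (x : Kij j i) : ofKij (c *: x) = vsval c * ofKij x.
Proof. by []. Qed.

Lemma toKijZ j i (c : Kv j) (x : KL) : toKij j i (vsval c * x) = c *: toKij j i x.
Proof. exact: (@linearZZ _ _ _ (@vsproj _ _ (Vij j i))). Qed.

Lemma tensDl j i (X : vectType (Kv i)) (e e' : Ebim j i) (x : X) :
  tens (e + e') x = tens e x + tens e' x.
Proof. by apply/ffunP => p; rewrite !ffunE ofKijD mulrDl toKijD. Qed.

Lemma tensDr j i (X : vectType (Kv i)) (e : Ebim j i) (x x' : X) :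
  tens e (x + x') = tens e x + tens e x'.
Proof. by apply/ffunP => p; rewrite !ffunE !raddfD /= mulrDr toKijD. Qed.

Lemma tensZl j i (X : vectType (Kv i)) c (e : Ebim j i) (x : X) :
  tens (c *: e) x = c *: tens e x.
Proof. by apply/ffunP => p; rewrite !ffunE ofKijZ -mulrA toKijZ. Qed.

Lemma tens_rscale j i (X : vectType (Kv i)) (e : Ebim j i) c (x : X) :
  tens (rscale e c) x = tens e (c *: x).
Proof.
apply/ffunP => p; rewrite !ffunE toKijK ?rpredM ?ofKij_mem ?vsvalK_mem //.
by rewrite linearZ /= -mulrA.
Qed.

Lemma tens_balanced j i (X : vectType (Kv i)) : balanced (@tens j i X).
Proof. by split=> *; rewrite (tensDl, tensDr, tens_rscale). Qed.

Lemma E_sum j i (e : Ebim j i) : e = \sum_a mono a (ofKij (e a)).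
Proof.
apply/ffunP => a; rewrite sum_ffunE (bigD1 a) //= big1 => [|b ba].
  by rewrite addr0 ffunE eqxx ofKijK.
by rewrite ffunE eq_sym (negPf ba).
Qed.

Lemma tensor_sum j i (X : vectType (Kv i)) (t : tensor j X) :
  t = \sum_p tens (mono p.1 (ofKij (t p))) (vbasis {:X})`_p.2.
Proof.
have frX : free (vbasis {:X}) by exact: basis_free (vbasisP _).
apply/ffunP => -[a l]; rewrite sum_ffunE (bigD1 (a, l)) //= big1 => [|[b l'] ne].
  by rewrite addr0 !ffunE eqxx /= coord_free // eqxx rmorph1 mulr1 !ofKijK.
rewrite !ffunE /= coord_free //; case: (a =P b) ne => [->|_] ne; last first.
  by rewrite ofKij0 mul0r toKij0.
have /negPf -> : l' != l by apply: contraNneq ne => ->.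
by rewrite rmorph0 mulr0 toKij0.
Qed.

Section Lift.
Variables (j i : 'I_n) (X : vectType (Kv i)) (Y : zmodType).
Variables (B : Ebim j i -> X -> Y) (Bbal : balanced B).

Let Bl : forall x, zmod_morphism (B ^~ x).
Proof.
case: Bbal => BD _ _ x e e' /=; apply: (addIr (B e' x)).
by rewrite -BD !subrK.
Qed.

Let Br : forall e, zmod_morphism (B e).
Proof.
case: Bbal => _ BD _ e x x' /=; apply: (addIr (B e x')).
by rewrite -BD !subrK.
Qed.

Let Bl_sum I (r : seq I) (Q : pred I) (F : I -> Ebim j i) x :
  B (\sum_(k <- r | Q k) F k) x = \sum_(k <- r | Q k) B (F k) x.
Proof.
pose aM := GRing.isZmodMorphism.Build _ _ (B ^~ x) (Bl x).
pose f : {additive Ebim j i -> Y} := HB.pack (B ^~ x) aM.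
exact: (raddf_sum f).
Qed.

Let Br_sum I (r : seq I) (Q : pred I) (F : I -> X) e :
  B e (\sum_(k <- r | Q k) F k) = \sum_(k <- r | Q k) B e (F k).
Proof.
pose aM := GRing.isZmodMorphism.Build _ _ (B e) (Br e).
pose f : {additive X -> Y} := HB.pack (B e) aM.
exact: (raddf_sum f).
Qed.

Lemma tlift_tens e x : tlift B (tens e x) = B e x.
Proof.
case: (Bbal) => _ _ Bc.
rewrite [in RHS](E_sum e) Bl_sum /tlift.
pose F a (l : 'I_(\dim {:X})) :=
  B (mono a (ofKij (tens e x (a, l)))) (vbasis {:X})`_l.
rewrite (eq_bigr (fun p => F p.1 p.2)) => [|[a l] _] //.
rewrite -(pair_bigA _ F) /F /=.
apply: eq_bigr => a _; rewrite {2}(coord_vbasis (memvf x)) Br_sum.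
apply: eq_bigr => l _; rewrite -Bc; congr B; apply/ffunP => a'; rewrite !ffunE /=.
case: eqP => _; last by rewrite ofKij0 mul0r toKij0.
by rewrite !ofKijK.
Qed.

Lemma tlift_additive : zmod_morphism (tlift B).
Proof.
move=> t u; rewrite /tlift -sumrB; apply: eq_bigr => p _.
rewrite -Bl; congr B; apply/ffunP => a; rewrite !ffunE.
by case: eqP => _; rewrite ?subr0 // !ofKijK.
Qed.

Lemma tlift_unique (g : {additive tensor j X -> Y}) :
  (forall e x, g (tens e x) = B e x) -> g =1 tlift B.
Proof.
by move=> gB t; rewrite {1}(tensor_sum t) raddf_sum; apply: eq_bigr => p _.
Qed.

End Lift.

Lemma tlift_scalable j i (X : vectType (Kv i)) (Y : lmodType (Kv j))
    (B : Ebim j i -> X -> Y) :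
  (forall c e x, B (c *: e) x = c *: B e x) -> scalable (tlift B).
Proof.
move=> BZ c t; rewrite /tlift scaler_sumr; apply: eq_bigr => p _.
rewrite -BZ; congr B; apply/ffunP => a; rewrite !ffunE.
by case: eqP => _; rewrite ?scaler0 // !ofKijK.
Qed.

(* The tensor product is taken along pact j i = M_{j <- i}.  The entry at j = i
   carries no information, since there are no loops. *)
Record pmodule := PModule {
  car : forall i, vectType (Kv i);
  pact : forall j i, 'Hom(tensor j (car i), car j);
  pact_rel : forall i (m : car i),
    \sum_(j | j != i) (\sum_(a : arrow P i j) \sum_k
      pact i j (tens (mono (arrow_star a) (tnth (dbas P j i) k))
        (pact j i (tens (mono a (tnth (bas P j i) k)) m)))) *~ vsgn P i j = 0 }.

Definition dimvec (R : realType) (M : pmodule) : 'rV[R]_n :=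
  \sum_i (\dim {:car M i})%:R *: alpha R i.

Record mhom (M N : pmodule) := MHom {
  mhom_map :> forall i, 'Hom(car M i, car N i);
  mhom_act : forall j i (e : Ebim j i) (m : car M i),
    mhom_map j (pact M j i (tens e m)) = pact N j i (tens e (mhom_map i m)) }.

Definition miso (M N : pmodule) := exists f : mhom M N, forall i, bijective (f i).

Definition brick (M : pmodule) :=
  (exists i (m : car M i), m != 0) /\
  forall f : mhom M M, (exists i (m : car M i), f i m != 0) ->
  exists g : mhom M M, forall i, cancel (f i) (g i) /\ cancel (g i) (f i).

Lemma simple_mod_rel i (X : forall k, vectType (Kv k)) (m : X i) :
  \sum_(j | j != i) (\sum_(a : arrow P i j) \sum_k
      (0 : 'Hom(tensor i (X j), X i)) (tens (mono (arrow_star a) (tnth (dbas P j i) k))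
        ((0 : 'Hom(tensor j (X i), X j)) (tens (mono a (tnth (bas P j i) k)) m))))
    *~ vsgn P i j = 0.
Proof.
apply: big1 => j _; rewrite big1 ?mul0rz // => a _.
by rewrite big1 // => k _; rewrite lfunE.
Qed.

(* The space at k is kappa(d_i) for k = i and 0 otherwise, as (k == i) is read
   as 1 or 0. *)
Definition simple_mod i : pmodule :=
  @PModule (fun k => 'rV[Kv k]_(k == i)) (fun j k => 0)
           (fun k => @simple_mod_rel k _).

Definition NoSub i (M : pmodule) :=
  ~ exists f : mhom (simple_mod i) M, forall k, injective (f k).

Definition NoQuot i (M : pmodule) :=
  ~ exists f : mhom M (simple_mod i),
      forall k (y : car (simple_mod i) k), exists x, f k x = y.

(* M_{del i}, a direct sum over a finite index set seen as a product; the
   summand at j = i is zero since there are no loops. *)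
Definition Mdel i (M : pmodule) := forall j, tensor i (car M j).

Definition in_map i (M : pmodule) (t : Mdel i M) : car M i :=
  \sum_(j | j != i) pact M i j (t j) *~ vsgn P i j.

Definition out_map i (M : pmodule) (m : car M i) : Mdel i M := fun j =>
  \sum_(a : arrow P i j) \sum_k
    tens (mono (arrow_star a) (tnth (dbas P j i) k))
         (pact M j i (tens (mono a (tnth (bas P j i) k)) m)).

(* Modules M and N with the same data away from the vertex i, the
   identification being given by the maps th k for k <> i (th i is not used). *)
Definition same_off i (M N : pmodule) (th : forall k, 'Hom(car N k, car M k)) :=
  (forall k, k != i -> bijective (th k)) /\
  (forall k l, k != i -> l != i -> forall (e : Ebim l k) (x : car N k),
     th l (pact N l k (tens e x)) = pact M l k (tens e (th k x))).

Definition Mdel_map i (M N : pmodule) (th : forall k, 'Hom(car N k, car M k))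
  (t : Mdel i N) : Mdel i M := fun j => tmap (th j) (t j).

(* N is, up to isomorphism, Sigma_i^+(M): N_i is embedded by iota in M_{del i}
   with image the kernel of the in-map; under this embedding the out-map of N is
   the inclusion and its in-map is the composite of the in- and out-maps of M. *)
Definition is_Sigma_plus i (M N : pmodule) :=
  exists (th : forall k, 'Hom(car N k, car M k))
         (iota : forall j, 'Hom(car N i, tensor i (car M j))),
  [/\ same_off i th,
      (forall x, (forall j, iota j x = 0) -> x = 0),
      (forall t : Mdel i M, in_map t = 0 <-> exists x, forall j, t j = iota j x),
      (forall x j, Mdel_map th (out_map x) j = iota j x) &
      (forall (t : Mdel i N) j,
         iota j (in_map t) = out_map (in_map (Mdel_map th t)) j)].

(* N is, up to isomorphism, Sigma_i^-(M): N_i is the target of a surjection pi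
   from M_{del i} with kernel the image of the out-map; the in-map of N is pi and
   its out-map is induced by the composite of the in- and out-maps of M. *)
Definition is_Sigma_minus i (M N : pmodule) :=
  exists (th : forall k, 'Hom(car N k, car M k))
         (pi_ : forall j, 'Hom(tensor i (car M j), car N i)),
  let pi (t : Mdel i M) := \sum_j pi_ j (t j) in
  [/\ same_off i th,
      (forall x, exists t, pi t = x),
      (forall t, pi t = 0 <-> exists m, forall j, t j = out_map m j),
      (forall t : Mdel i N, in_map t = pi (Mdel_map th t)) &
      (forall t j, Mdel_map th (out_map (pi t)) j = out_map (in_map t) j)].

(* For w = [:: (e_1, i_1); ...; (e_r, i_r)], with true for the sign +, the
   expression Sigma_{i_r}^{e_r} ... Sigma_{i_1}^{e_1} M is well-defined and its
   value is isomorphic to N. *)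
Fixpoint is_Sigma_expr (w : seq (bool * 'I_n)) (M N : pmodule) : Prop :=
  match w with
  | [::] => miso M N
  | (e, i) :: w' => exists M',
      (if e then NoQuot i M /\ is_Sigma_plus i M M'
       else NoSub i M /\ is_Sigma_minus i M M')
      /\ is_Sigma_expr w' M' N
  end.

End Preprojective.

(* Main.v *)
From HB Require Import structures.
Require Import Defs.
From mathcomp Require Import all_boot all_order all_fingroup all_algebra.
From mathcomp Require Import all_solvable all_field.
From mathcomp Require Import reals ring.

Set Implicit Arguments.
Unset Strict Implicit.
Unset Printing Implicit Defensive.

Import Order.TTheory GRing.Theory Num.Theory.
Local Open Scope ring_scope.

(** Fix a vertex i.  For modules M and N that agree away from i, both
    N = Sigma_i^+ M (with M in NoQuot_i) and M = Sigma_i^- N (with N in NoSub_i)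
    say the same thing ([linked i M N]): there is a short exact sequence

      0 -> N_i -> M_{del i} -> M_i -> 0

    made of the out-map of N and the in-map of M, and the two composites
    out o in : M_{del i} -> M_{del i}, one for M and one for N, coincide
    ([linked_plus], [linked_minus]).  Everything follows from this symmetric
    relation.

    - Dimensions in the exact sequence give dim N = s_i (dim M)
      ([linked_dimvec]).
    - An endomorphism of M or of N is determined by its components away from i,
      and those components extend from one module to the other: to M_i because it
      is a cokernel, to N_i because it is a kernel.  Hence M is a brick if and
      only if N is ([reflects_brick]).
    - Every M in NoQuot_i has a partner N, namely the kernel construction, and
      every N in NoSub_i a partner M, the cokernel construction
      ([exists_Sigma_plus], [exists_Sigma_minus]).
    - A brick that has S_i both as a submodule and as a quotient has the
      endomorphism M -> S_i -> M, which is nonzero and so invertible; such a brick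
      is of dimension alpha_i ([brick_trichotomy]).

    Let x >= 0 be a step of the expression, with s_i x = x + c alpha_i and c > 0.
    A brick of dimension s_i x is in NoSub_i or in NoQuot_i, as s_i x = alpha_i
    would make x = - alpha_i.  In the first case it is Sigma_i^+, in the second
    Sigma_i^-, of a brick of dimension x; conversely both reflections turn bricks of
    dimension x into bricks of dimension s_i x.  Induction on the length of the
    expression ([bricks_along]) leads back to the bricks of dimension alpha_j, and
    the only one is S_j ([miso_simple], [simple_brick]).

    What makes the exact sequence available is the adjunction between
    E(j <- i) tensor - and E(i <- j) tensor -, given by the trace form: the
    component M_i -> E(i <- j) tensor M_j of the out-map and the action
    E(j <- i) tensor M_i -> M_j determine each other ([ev_out],
    [out_map_uniq]). *)

(** * Linear maps and finite direct sums *)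
Lemma linfunE (K : fieldType) (U V : vectType K) (f : U -> V) :
  linear f -> linfun f =1 f.
Proof.
move=> fL; pose aM := GRing.isLinear.Build K U V _ f fL.
pose g : {linear U -> V} := HB.pack f aM.
exact: (lfunE g).
Qed.

Lemma lfun_bijP (K : fieldType) (U V : vectType K) (f : 'Hom(U, V)) :
  bijective f -> cancel f f^-1%VF /\ cancel f^-1%VF f.
Proof.
move=> fbij; have fK : cancel f f^-1%VF by apply/lker0_lfunK/lker0P/bij_inj.
split=> //; case: fbij => g fg gf x.
by rewrite -{1}(gf x) fK gf.
Qed.

Lemma lfun_bij_dim (K : fieldType) (U V : vectType K) (f : 'Hom(U, V)) :
  bijective f -> \dim {:U} = \dim {:V}.
Proof.
move=> fbij; have [fK Kf] := lfun_bijP fbij.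
have k0 : lker f == 0%VS by apply/lker0P/bij_inj.
rewrite -(@limg_dim_eq _ _ _ f fullv) ?(eqP k0) ?capv0 //; congr (\dim _).
by apply/vspaceP=> v; rewrite memvf -(Kf v) memv_img ?memvf.
Qed.

Lemma lfun_section (K : fieldType) (U V : vectType K) (f : 'Hom(U, V)) :
  (forall y, exists x, f x = y) -> cancel f^-1%VF f.
Proof.
by move=> fs y; apply: limg_lfunVK; have [x <-] := fs y; rewrite memv_img ?memvf.
Qed.

(** A linear map that is not onto is detected by a linear form on its target;
    this form is what produces a simple quotient, or an endomorphism of rank one. *)
Lemma onto_or_annihilated (K : fieldType) (U V : vectType K) (f : 'Hom(U, V)) :
  (forall y, exists x, f x = y) \/
  (exists2 l : 'Hom(V, K^o), forall x, l (f x) = 0 & exists y, l y = 1).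
Proof.
have [ff|] := boolP (fullv <= limg f)%VS.
  left=> y; have /memv_imgP[x _ ->] : y \in limg f by apply: (subvP ff); apply: memvf.
  by exists x.
case/subvPn=> v _ vN; right.
pose g := (\1 - projv (limg f))%VF.
have gv : g v != 0.
  rewrite add_lfunE opp_lfunE id_lfunE subr_eq0.
  by apply: contraNneq vN => {1}->; rewrite memv_proj.
have [l lv] : exists l : 'Hom(V, K^o), l (g v) = 1.
  have [q cq] : exists q, coord (vbasis {:V}) q (g v) != 0.
    apply/existsP; apply: contraNT gv; rewrite negb_exists => /forallP c0.
    rewrite (coord_vbasis (memvf (g v))) big1 // => q _.
    by move: (c0 q); rewrite negbK => /eqP ->; rewrite scale0r.
  have hE := @linfunE _ V K^o (coord (vbasis {:V}) q) (linearP _).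
  exists ((coord (vbasis {:V}) q (g v))^-1 *: linfun (coord (vbasis {:V}) q : V -> K^o)).
  by rewrite scale_lfunE hE /GRing.scale /= mulVf.
exists (l \o g)%VF => [x|]; last by exists v; rewrite comp_lfunE.
rewrite comp_lfunE add_lfunE opp_lfunE id_lfunE projv_id ?memv_img ?memvf //.
by rewrite subrr linear0.
Qed.

Section DirectSum.
Variables (K : fieldType) (I : finType) (X : I -> vectType K).

(** The summands depend on the index, so the sum is encoded by coordinates:
    one scalar for each index and each basis vector of its summand. *)
Definition dsum : vectType K :=
  {ffun {i : I & 'I_(\dim {:X i})} -> K^o}.

Definition dpack (t : forall i, X i) : dsum :=
  [ffun p => coord (vbasis {:X (tag p)}) (tagged p) (t (tag p))].

Definition dproj i (u : dsum) : X i :=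
  \sum_q u (existT (fun i => 'I_(\dim {:X i})) i q) *: (vbasis {:X i})`_q.

Lemma dproj_linear i : linear (dproj i).
Proof.
move=> c u v; rewrite /dproj scaler_sumr -big_split; apply: eq_bigr => q _ /=.
by rewrite !ffunE scalerDl scalerA.
Qed.
HB.instance Definition _ i := GRing.isLinear.Build K dsum (X i) _ (dproj i)
  (dproj_linear i).

Lemma dprojK i t : dproj i (dpack t) = t i.
Proof.
rewrite [RHS](coord_vbasis (memvf (t i))).
by apply: eq_bigr => q _; rewrite ffunE.
Qed.

Lemma dpackK u : dpack (dproj^~ u) = u.
Proof.
apply/ffunP=> -[i q]; rewrite ffunE /= /dproj coord_sum_free //.
exact: basis_free (vbasisP _).
Qed.

Lemma dsum_eq u v : (forall i, dproj i u = dproj i v) -> u = v.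
Proof.
by move=> uv; rewrite -(dpackK u) -(dpackK v); apply/ffunP=> p; rewrite !ffunE uv.
Qed.

Lemma dim_dsum : \dim {:dsum} = (\sum_i \dim {:X i})%N.
Proof.
rewrite dimvf /dim /= muln1 card_tagged sumnE big_map big_enum /=.
by apply: eq_bigr => i _; rewrite card_ord.
Qed.

Lemma dpack_linear (U : vectType K) (f : forall i, 'Hom(U, X i)) :
  linear (fun x => dpack (fun i => f i x)).
Proof.
move=> c x y; apply: dsum_eq => i.
by rewrite linearP /= !dprojK linearP.
Qed.

End DirectSum.

(** * The trace form and its dual bases *)
Section Trace.
Variables (n : nat) (C : cartan n) (k0 : fieldType) (KL : splittingFieldType k0).
Variable P : preproj_datum C KL.
Variables (j i : 'I_n).
Hypothesis ji : i != j.
Local Notation Kj := (kap P (cd C j)).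
Local Notation Kji := (kap P (dd C j i)).
Local Notation b := (tnth (bas P j i)).
Local Notation b' := (tnth (dbas P j i)).
Local Notation T := (galTrace Kj Kji).

Lemma bas_mem k : b k \in Kji.
Proof.
rewrite -(mem_aspaceOver (K_sub_l P j i)).
exact: basis_mem (bas_basis P ji) (mem_tnth k (bas P j i)).
Qed.

Lemma galTraceZ c x : c \in Kj -> T (c * x) = c * T x.
Proof.
move=> cK; rewrite /galTrace mulr_sumr; apply: eq_bigr => f fG.
by rewrite rmorphM /= (fixed_gal (K_sub_l P j i) fG cK).
Qed.

Lemma bas_expansion y : y \in Kji ->
  exists2 c : 'I__ -> KL, (forall k, c k \in Kj) & y = \sum_k c k * b k.
Proof.
rewrite -(mem_aspaceOver (K_sub_l P j i)) => yV.
exists (fun k => vsval (coord (bas P j i : _.-tuple (fieldOver Kj)) k y)).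
  by move=> k; rewrite subvsP.
rewrite {1}(@coord_basis _ _ _ _ (bas P j i : _.-tuple (fieldOver Kj)) _ (bas_basis P ji) yV).
by apply: eq_bigr => k _; rewrite -tnth_nth fieldOver_scaleE.
Qed.

(** The dual basis reads off coordinates; the values of the trace are therefore
    scalars, which [mem_galTrace_kap] extracts by writing x as (x / b'_l) b'_l. *)
Lemma galTrace_bas_dbas (c : 'I__ -> KL) l : (forall k, c k \in Kj) ->
  T ((\sum_k c k * b k) * b' l) = c l.
Proof.
move=> cK; rewrite mulr_suml raddf_sum (bigD1 l) //= big1 => [|k kl].
  by rewrite -mulrA galTraceZ // dbas_dual // eqxx mulr1 addr0.
by rewrite -mulrA galTraceZ // dbas_dual // (negPf kl) mulr0.
Qed.

Lemma bas_galTrace y : y \in Kji -> y = \sum_k T (y * b' k) * b k.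
Proof.
move=> /bas_expansion[c cK ->]; apply: eq_bigr => k _.
by rewrite galTrace_bas_dbas.
Qed.

Lemma bas_index : 'I_(dd C j i %/ cd C j).
Proof.
have d0 : (0 < dd C j i)%N by rewrite lcmn_gt0 !cd_gt0.
by exists 0%N; rewrite divn_gt0 ?cd_gt0 // dvdn_leq // dvdn_lcml.
Qed.

Lemma mem_galTrace_kap x : x \in Kji -> T x \in Kj.
Proof.
move=> xK; pose l := bas_index; have d'K := dbas_mem P ji l.
have [b0|b0] := eqVneq (b' l) 0.
  by have /eqP := dbas_dual P ji l l; rewrite b0 mulr0 raddf0 eqxx eq_sym oner_eq0.
have : x / b' l \in Kji by rewrite rpredM ?rpredV.
case/bas_expansion=> c cK E.
by have := galTrace_bas_dbas l cK; rewrite -E divfK // => ->.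
Qed.

(** The trace form is nondegenerate, as it takes the value 1: if u were
    invertible, u times a suitable element would be b_l b'_l, of trace 1. *)
Lemma galTrace_eq0 u : u \in Kji -> (forall k, T (b k * u) = 0) -> u = 0.
Proof.
move=> uK u0; apply/eqP; apply: contraT => nu.
pose l := bas_index.
have /bas_expansion[c cK E] : b l * b' l / u \in Kji.
  by rewrite !rpredM ?rpredV ?bas_mem ?dbas_mem.
have : T (b l * b' l / u * u) = 0.
  rewrite E mulr_suml raddf_sum big1 // => k _.
  by rewrite -mulrA /= galTraceZ // u0 mulr0.
by rewrite divfK // dbas_dual // eqxx => /eqP; rewrite oner_eq0.
Qed.

Definition trK (x : KL) : Kv P j := vsproj Kj (T x).

Lemma trK_zmod : zmod_morphism trK.
Proof. by move=> x y; rewrite /trK !raddfB. Qed.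
HB.instance Definition _ := GRing.isZmodMorphism.Build KL (Kv P j) trK trK_zmod.

Lemma trKZ (c : Kv P j) x : x \in Kji -> trK (vsval c * x) = c * trK x.
Proof.
move=> xK; rewrite /trK galTraceZ ?subvsP //.
by apply: subvs_inj; rewrite rmorphM /= !vsprojK ?rpredM ?subvsP ?mem_galTrace_kap.
Qed.

Lemma vsval_trK x : x \in Kji -> vsval (trK x) = T x.
Proof. by move=> xK; rewrite vsprojK ?mem_galTrace_kap. Qed.

Lemma bas_trK y : y \in Kji -> y = \sum_k vsval (trK (y * b' k)) * b k.
Proof.
move=> yK; rewrite {1}(bas_galTrace yK); apply: eq_bigr => k _.
by rewrite vsval_trK // rpredM ?dbas_mem.
Qed.

End Trace.

(** * Tensor products along the arrows *)
Section Tensor.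
Variables (n : nat) (C : cartan n) (k0 : fieldType) (KL : splittingFieldType k0).
Variable P : preproj_datum C KL.
Implicit Types i j : 'I_n.

Lemma tensor_ind j i (X : vectType (Kv P i)) (Q : tensor j X -> Prop) :
    Q 0 -> (forall t u, Q t -> Q u -> Q (t + u)) -> (forall e x, Q (tens e x)) ->
  forall t, Q t.
Proof. by move=> Q0 QD Qt t; rewrite (tensor_sum t); apply: big_ind => // p _. Qed.

Lemma tens0 j i (X : vectType (Kv P i)) (e : Ebim P j i) : tens e (0 : X) = 0.
Proof. by apply: (addrI (tens e 0)); rewrite -tensDr !addr0. Qed.

(** There are no loops, so statements about the summand at j = i hold for trivial
    reasons; equality of the vertices is a hypothesis to avoid dependent rewriting. *)
Lemma tensor_loop i j (X : vectType (Kv P j)) (t u : tensor i X) : i = j -> t = u.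
Proof.
move=> E; move: X t u; rewrite {}E => X t u.
apply/ffunP=> -[a q]; have /eqP := arrow_loop P j.
by rewrite -leqn0 leqNgt => /negP[]; apply/card_gt0P; exists a.
Qed.

Lemma dim_Kij j i : \dim {:Kij P j i} = (dd C j i %/ cd C j)%N.
Proof.
rewrite dimvf /dim /= dim_aspaceOver ?K_sub_l // !kap_dim ?dd_dvd //.
by rewrite (dvdn_trans _ (dd_dvd C j j)) // dvdn_lcml.
Qed.

(** The number of arrows is - d_i A_ij / d_ij = - d_j A_ji / d_ij, and each of them
    contributes [kappa(d_ij) : kappa(d_j)] = d_ij / d_j copies of X. *)
Lemma dim_tensor j i (X : vectType (Kv P i)) : i != j ->
  (\dim {:tensor j X})%:Z = - cA C j i * (\dim {:X})%:Z.
Proof.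
move=> ij; have cj0 : ((cd C j)%:Z != 0) by rewrite eqz_nat -lt0n cd_gt0.
apply: (mulfI cj0); rewrite mulrA mulrN -(cA_sym C) -(arrow_card P ij).
have -> : \dim {:tensor j X} = (#|arrow P i j| * \dim {:X} * \dim {:Kij P j i})%N.
  by rewrite dimvf [in RHS](dimvf (Kij P j i)) /dim /= card_prod card_ord.
rewrite dim_Kij -!PoszM; congr Posz.
have -> : dd C i j = dd C j i by rewrite /dd lcmnC.
by rewrite [LHS]mulnC -!mulnA divnK ?dvdn_lcml // [in RHS](mulnC (dd C j i)).
Qed.

Lemma mono_linear j i (a : arrow P i j) (c : 'I_(dd C j i %/ cd C j) -> Kv P j) b :
  mono a (\sum_k vsval (c k) * b k) = \sum_k c k *: mono a (b k).
Proof.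
apply/ffunP=> a'; rewrite sum_ffunE ffunE; case: eqP => [->|/eqP ne].
  rewrite /toKij raddf_sum; apply: eq_bigr => k _.
  by rewrite !ffunE eqxx -toKijZ.
by rewrite big1 // => k _; rewrite !ffunE (negPf ne) scaler0.
Qed.

Lemma kap_ddC j i : kap P (dd C i j) = kap P (dd C j i).
Proof. by rewrite /dd lcmnC. Qed.

Lemma ofKij_memC j i (x : Kij P i j) : ofKij x \in kap P (dd C j i).
Proof. by rewrite -kap_ddC ofKij_mem. Qed.

Section TMap.
Variables (j i : 'I_n) (X X' : vectType (Kv P i)) (f : 'Hom(X, X')).

Lemma tmap_balanced : balanced (fun e x => @tens _ _ _ _ P j i X' e (f x)).
Proof.
by split=> *; rewrite ?tensDl ?linearD ?tensDr //= tens_rscale linearZ.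
Qed.

Lemma tmap_tens e x : tmap f (@tens _ _ _ _ P j i X e x) = tens e (f x).
Proof. exact: (tlift_tens tmap_balanced). Qed.

HB.instance Definition _ := GRing.isZmodMorphism.Build (tensor j X) (tensor j X')
  (@tmap _ _ _ _ P j i X X' f) (tlift_additive tmap_balanced).

Lemma tmap_scalable : scalable (@tmap _ _ _ _ P j i X X' f).
Proof. by apply: tlift_scalable => d e x; rewrite tensZl. Qed.

HB.instance Definition _ := GRing.isScalable.Build _ (tensor j X) (tensor j X') _
  (@tmap _ _ _ _ P j i X X' f) tmap_scalable.

End TMap.

Lemma eq_tmap j i (X X' : vectType (Kv P i)) (f g : 'Hom(X, X')) (t : tensor j X) :
  f =1 g -> tmap f t = tmap g t.
Proof. by move=> fg; rewrite (lfunP f g).1. Qed.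

Lemma tmap_comp j i (X X' X'' : vectType (Kv P i)) (f : 'Hom(X', X''))
    (g : 'Hom(X, X')) (t : tensor j X) :
  tmap f (tmap g t) = tmap (f \o g)%VF t.
Proof.
elim/tensor_ind: t => [|t u IHt IHu|e x]; first by rewrite !raddf0.
  by rewrite !raddfD /= IHt IHu.
by rewrite !tmap_tens comp_lfunE.
Qed.

Lemma tmap_id j i (X : vectType (Kv P i)) (f : 'Hom(X, X)) (t : tensor j X) :
  f =1 id -> tmap f t = t.
Proof.
move=> f1; elim/tensor_ind: t => [|t u IHt IHu|e x]; first by rewrite !raddf0.
  by rewrite !raddfD /= IHt IHu.
by rewrite tmap_tens f1.
Qed.

Lemma tmapK j i (X X' : vectType (Kv P i)) (f : 'Hom(X, X')) (g : 'Hom(X', X)) :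
  cancel f g -> cancel (@tmap _ _ _ _ P j i X X' f) (tmap g).
Proof. by move=> fK t; rewrite tmap_comp tmap_id // => x; rewrite comp_lfunE. Qed.

(** ** The adjunction given by the trace form *)
Section Evaluation.
Variables (j i : 'I_n).
Hypothesis ij : i != j.

Section Ev.
Variable Y : vectType (Kv P j).
Implicit Types (e : Ebim P j i) (t : tensor i Y).

(** The pairing E(j <- i) x (E(i <- j) tensor Y) -> Y, which contracts an arrow
    with its opposite by the trace form: it sends (a u, a^* v tensor y) to
    tr(u v) y. *)
Definition ev e t : Y :=
  \sum_a \sum_q trK P j i (ofKij (e a) * ofKij (t (arrow_star a, q)))
    *: (vbasis {:Y})`_q.

Lemma evDl e e' t : ev (e + e') t = ev e t + ev e' t.
Proof.
rewrite /ev -big_split; apply: eq_bigr => a _; rewrite -big_split.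
by apply: eq_bigr => q _ /=; rewrite ffunE ofKijD mulrDl raddfD scalerDl.
Qed.

Lemma evDr e t t' : ev e (t + t') = ev e t + ev e t'.
Proof.
rewrite /ev -big_split; apply: eq_bigr => a _; rewrite -big_split.
by apply: eq_bigr => q _ /=; rewrite ffunE ofKijD mulrDr raddfD scalerDl.
Qed.

Lemma ev0 e : ev e 0 = 0.
Proof. by apply: (addrI (ev e 0)); rewrite -evDr !addr0. Qed.

Lemma evZl c e t : ev (c *: e) t = c *: ev e t.
Proof.
rewrite /ev scaler_sumr; apply: eq_bigr => a _; rewrite scaler_sumr.
apply: eq_bigr => q _ /=; rewrite ffunE ofKijZ -mulrA trKZ ?scalerA //.
by rewrite rpredM ?ofKij_mem ?ofKij_memC.
Qed.

Lemma ev_rscale e c t : ev (rscale e c) t = ev e (c *: t).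
Proof.
apply: eq_bigr => a _; apply: eq_bigr => q _ /=; rewrite !ffunE ofKijZ.
by rewrite toKijK ?mulrA // rpredM ?ofKij_mem ?vsvalK_mem.
Qed.

Lemma ev_tens e (f : Ebim P i j) y :
  ev e (tens f y) = (\sum_a trK P j i (ofKij (e a) * ofKij (f (arrow_star a)))) *: y.
Proof.
rewrite /ev scaler_suml; apply: eq_bigr => a _.
rewrite [in RHS](coord_vbasis (memvf y)) scaler_sumr; apply: eq_bigr => q _.
rewrite ffunE /= toKijK; last by rewrite rpredM ?ofKij_mem ?vsvalK_mem.
rewrite mulrA mulrC trKZ ?scalerA 1?mulrC //.
by rewrite rpredM ?ofKij_mem ?ofKij_memC.
Qed.

Lemma ev_sum e I (r : seq I) (Q : pred I) (F : I -> tensor i Y) :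
  ev e (\sum_(k <- r | Q k) F k) = \sum_(k <- r | Q k) ev e (F k).
Proof. exact: (big_morph (ev e) (evDr e) (ev0 e)). Qed.

(** Testing t against the elements b_k on the arrow opposite to a shows that
    the coefficients of t at a are orthogonal to all b_k for the trace form. *)
Lemma ev_eq0 t : (forall e, ev e t = 0) -> t = 0.
Proof.
move=> t0; apply/ffunP=> -[a q]; rewrite ffunE -[LHS]ofKijK -[RHS]ofKijK ofKij0.
congr toKij; apply: (galTrace_eq0 (P:=P) ij); first exact: ofKij_memC.
move=> k; rewrite -(vsval_trK ij) ?rpredM ?ofKij_memC ?bas_mem //.
pose e := mono (arrow_star a) (tnth (bas P j i) k).
have := t0 e; rewrite /ev (bigD1 (arrow_star a)) //= [X in _ + X]big1 ?addr0.
  move=> E; have /freeP frY : free (vbasis {:Y}) by exact: basis_free (vbasisP _).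
  have := frY _ E q; rewrite ffunE eqxx toKijK ?bas_mem // arrow_starK => ->.
  by rewrite rmorph0.
move=> b ba; rewrite big1 // => l _.
by rewrite ffunE (negPf ba) ofKij0 mul0r raddf0 scale0r.
Qed.

Lemma ev_inj t u : (forall e, ev e t = ev e u) -> t = u.
Proof.
move=> tu; apply/eqP; rewrite -subr_eq0; apply/eqP/ev_eq0 => e.
by apply: (addIr (ev e u)); rewrite -evDr subrK add0r tu.
Qed.

(** The canonical element sum b'_k a^* tensor B(a b_k) that represents the linear
    map B through the pairing; out-maps are of this shape. *)
Definition adj (B : Ebim P j i -> Y) : tensor i Y :=
  \sum_(a : arrow P i j) \sum_k
    tens (mono (arrow_star a) (tnth (dbas P j i) k)) (B (mono a (tnth (bas P j i) k))).

Lemma ev_adj (B : Ebim P j i -> Y) e : linear B -> ev e (adj B) = B e.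
Proof.
move=> BL; pose g : 'Hom(Ebim P j i, Y) := linfun B.
have gB : g =1 B by apply: linfunE.
rewrite -gB ev_sum [in RHS](E_sum e) linear_sum; apply: eq_bigr => a _.
rewrite (bas_trK (P:=P) ij (ofKij_mem (e a))) mono_linear linear_sum ev_sum.
apply: eq_bigr => k _; rewrite linearZ /= ev_tens gB; congr (_ *: _).
rewrite (bigD1 a) //= big1 ?addr0 => [|b ba].
  by rewrite ffunE eqxx toKijK // kap_ddC dbas_mem.
rewrite ffunE; case: eqP => [E|_]; last by rewrite ofKij0 mulr0 raddf0.
by rewrite -(arrow_starK b) E arrow_starK eqxx in ba.
Qed.

End Ev.

Lemma ev_tmap (Y Y' : vectType (Kv P j)) (f : 'Hom(Y, Y')) e (t : tensor i Y) :
  ev e (tmap f t) = f (ev e t).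
Proof.
elim/tensor_ind: t => [|t u IHt IHu|e' x]; first by rewrite raddf0 !ev0 raddf0.
  by rewrite raddfD /= !evDr raddfD IHt IHu.
by rewrite tmap_tens !ev_tens linearZ.
Qed.

End Evaluation.
End Tensor.

(** * The in-map and the out-map *)
Section Modules.
Variables (n : nat) (C : cartan n) (k0 : fieldType) (KL : splittingFieldType k0).
Variable P : preproj_datum C KL.
Implicit Types (i j : 'I_n) (M N : pmodule P).

Lemma pact_tens_linear M j i (m : car M i) : linear (fun e => pact M j i (tens e m)).
Proof. by move=> c e e'; rewrite tensDl tensZl linearP. Qed.

Lemma ev_out M i j (e : Ebim P j i) (m : car M i) : i != j ->
  ev e (out_map m j) = pact M j i (tens e m).
Proof. by move=> ij; apply: (ev_adj ij (B := fun e => pact M j i (tens e m)) e (@pact_tens_linear M j i m)). Qed.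

(** The pairing is nondegenerate, so the equation of [ev_out] characterizes the
    out-map; identities on out-maps reduce to identities on actions in this way. *)
Lemma out_map_uniq M i j (m : car M i) (t : tensor i (car M j)) :
  (i != j -> forall e, ev e t = pact M j i (tens e m)) -> out_map m j = t.
Proof.
have [E _|ij tE] := altP (i =P j); first exact: tensor_loop.
have {}tE := tE isT.
by apply: (ev_inj ij) => e; rewrite tE ev_out.
Qed.

Lemma out_map_linear M i j : linear (fun m : car M i => out_map m j).
Proof.
move=> c m m'; apply: out_map_uniq => ij e.
by rewrite evDr -ev_rscale // !ev_out // tens_rscale tensDr raddfD.
Qed.

Definition outH M i j : 'Hom(car M i, tensor i (car M j)) :=
  linfun (fun m => out_map m j).

Lemma outHE M i j (m : car M i) : outH M i j m = out_map m j.
Proof. exact/linfunE/out_map_linear. Qed.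

Lemma pact_out0 M i j (e : Ebim P j i) (m : car M i) :
  out_map m j = 0 -> pact M j i (tens e m) = 0.
Proof.
have [ij m0|ij m0] := altP (i =P j).
  by rewrite (tensor_loop (tens e m) 0) ?raddf0.
by rewrite -ev_out // m0 ev0.
Qed.

Section InMap.
Variables (M : pmodule P) (i : 'I_n).
Local Notation D := (dsum (fun j => tensor i (car M j))).

Lemma in_map_ext (t u : Mdel i M) : (forall j, j != i -> t j = u j) -> in_map t = in_map u.
Proof. by move=> tu; apply: eq_bigr => j ji; rewrite tu. Qed.

Definition inD : 'Hom(D, car M i) := linfun (fun d => in_map (fun j => dproj j d)).

Lemma inDE d : inD d = in_map (fun j => dproj j d).
Proof.
apply: linfunE => c u v; rewrite /in_map scaler_sumr -big_split.
apply: eq_bigr => j _ /=.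
by rewrite !linearP /= mulrzDl -!scaler_int !scalerA [_ * c]mulrC.
Qed.

Lemma inD_pack t : inD (dpack t) = in_map t.
Proof. by rewrite inDE; apply: in_map_ext => j _; rewrite dprojK. Qed.

Definition outD : 'Hom(car M i, D) := linfun (fun m => dpack (fun j => outH M i j m)).

Lemma dproj_outD m j : dproj j (outD m) = out_map m j.
Proof. by rewrite linfunE ?dprojK ?outHE //; apply: dpack_linear. Qed.

Lemma in_out (m : car M i) : in_map (out_map m) = 0.
Proof.
rewrite -[RHS](pact_rel m); apply: eq_bigr => j _; congr (_ *~ _).
rewrite /out_map raddf_sum; apply: eq_bigr => a _; rewrite raddf_sum.
by apply: eq_bigr.
Qed.

Lemma inD_outD m : inD (outD m) = 0.
Proof. by rewrite inDE -[RHS](in_out m); apply: in_map_ext => j _; rewrite dproj_outD. Qed.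

End InMap.

Lemma sgn_sq i j : i != j -> vsgn P i j * vsgn P i j = 1.
Proof. by case/(vsgn_pm P) => ->. Qed.

(** A linear form on M_i that vanishes on everything coming into i amounts to a
    homomorphism from M to S_i, so the second case says that S_i is a quotient. *)
Lemma exists_functional M i :
  (forall m : car M i, exists t, in_map t = m) \/
  exists2 l : 'Hom(car M i, (Kv P i)^o),
    (forall j t, i != j -> l (pact M i j t) = 0) & exists m, l m = 1.
Proof.
have [ons|[l l0 l1]] := onto_or_annihilated (inD M i).
  by left=> m; have [d <-] := ons m; exists (fun j => dproj j d); rewrite inDE.
right; exists l => // j t ij.
have := l0 (dpack (dfwith (fun j => 0 : tensor i (car M j)) t)).
rewrite inD_pack /in_map (bigD1 j) 1?eq_sym //= big1 => [|k /andP[ki kj]].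
  rewrite addr0 dfwith_in -scaler_int linearZ /=.
  case: (vsgn_pm P ij) => -> E; move: E; rewrite ?scale1r ?scaleN1r //.
  by move/eqP; rewrite oppr_eq0 => /eqP.
by rewrite dfwith_out 1?eq_sym // raddf0 mul0rz.
Qed.

(** A linear map at the vertex i alone is a homomorphism as soon as it kills what
    comes into i and its values are killed by what goes out of i. *)
Lemma hom_at_vertex M N i (f : 'Hom(car M i, car N i)) :
    (forall j t, i != j -> f (pact M i j t) = 0) ->
    (forall m j, i != j -> out_map (f m) j = 0) ->
  exists2 g : mhom M N, g i = f & forall k, k != i -> g k = 0.
Proof.
move=> fin fout.
pose F := dfwith (fun k => 0 : 'Hom(car M k, car N k)) f.
have Fi : F i = f by rewrite /F dfwith_in.
have Fk k : k != i -> F k = 0 by move=> ki; rewrite /F dfwith_out 1?eq_sym.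
have Fact j k (e : Ebim P j k) (m : car M k) :
    F j (pact M j k (tens e m)) = pact N j k (tens e (F k m)).
  have [E|kj] := altP (k =P j).
    by rewrite (tensor_loop (tens e m) 0) // (tensor_loop (tens e _) 0) // !raddf0.
  have [E|ki] := altP (k =P i); last rewrite (Fk k ki) zero_lfunE tens0 raddf0.
    by subst k; rewrite Fk 1?eq_sym // zero_lfunE Fi pact_out0 // fout.
  have [E|ji] := altP (j =P i); last by rewrite Fk // zero_lfunE.
  by subst j; rewrite Fi fin // eq_sym.
by exists (MHom Fact).
Qed.

(** The space of S_i at i is a row space of width (i == i), a number that is
    only propositionally 1. *)
Lemma simple_index i : 'I_(i == i).
Proof. by rewrite eqxx; exact: ord0. Qed.

Lemma simple_off i k (y z : car (simple_mod P i) k) : k != i -> y = z.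
Proof.
move=> ki; have F : 'I_(k == i) -> False by rewrite (negPf ki); case.
by apply/matrixP=> a b; case: (F b).
Qed.

Lemma simple_eq i (y z : car (simple_mod P i) i) :
  y 0 (simple_index i) = z 0 (simple_index i) -> y = z.
Proof.
have one (b c : 'I_(i == i)) : b = c by move: b c; rewrite eqxx => b c; rewrite !ord1.
by move=> yz; apply/matrixP=> a b; rewrite ord1 (one b (simple_index i)).
Qed.

Lemma NoQuotP M i : NoQuot i M <-> forall m : car M i, exists t, in_map t = m.
Proof.
split=> [nq|ons [f fs]].
  have [//|[l l0 [m0 lm0]]] := exists_functional M i; case: nq.
  pose fl : 'Hom(car M i, car (simple_mod P i) i) := linfun (fun m => const_mx (l m)).
  have flE m : fl m = const_mx (l m).
    apply: linfunE => c u v; apply/matrixP=> a b; rewrite !mxE.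
    by rewrite linearP.
  have [||g gi gk] := @hom_at_vertex M (simple_mod P i) i fl.
  - move=> j t ij; rewrite flE l0 //; by apply/matrixP=> a b; rewrite !mxE.
  - move=> m j ij; by apply: out_map_uniq => _ e /=; rewrite zero_lfunE ev0.
  exists g => k y; have [E|ki] := altP (k =P i); last by exists 0; apply: simple_off.
  subst k; exists (y 0 (simple_index i) *: m0).
  by rewrite gi linearZ /= flE lm0 /=; apply: simple_eq; rewrite !mxE mulr1.
have [x xE] := fs i (const_mx 1); have [t tx] := ons x.
have : f i x = 0.
  rewrite -tx raddf_sum big1 // => j ji; rewrite raddfMz.
  elim/tensor_ind: (t j) => [|u v|e z]; first by rewrite !raddf0 mul0rz.
    by rewrite !raddfD /= mulrzDl => -> ->; rewrite addr0.
  by rewrite [X in X *~ _](mhom_act f) /= zero_lfunE mul0rz.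
by rewrite xE => /matrixP/(_ 0 (simple_index i)); rewrite !mxE => /eqP; rewrite oner_eq0.
Qed.

Lemma NoSubP M i : NoSub i M <-> forall m : car M i, (forall j, out_map m j = 0) -> m = 0.
Proof.
split=> [ns m m0|outI [f fI]].
  have [//|nm] := eqVneq m 0; case: ns.
  pose q := simple_index i.
  pose fl : 'Hom(car (simple_mod P i) i, car M i) := linfun (fun v : 'rV[Kv P i]_(i == i) => v 0 q *: m).
  have flE (v : 'rV[Kv P i]_(i == i)) : fl v = v 0 q *: m.
    apply: linfunE => c u w; by rewrite !mxE scalerDl scalerA.
  have [||g gi gk] := @hom_at_vertex (simple_mod P i) M i fl.
  - by move=> j t ij; rewrite /= zero_lfunE raddf0.
  - by move=> v j _; rewrite -outHE flE linearZ /= outHE m0 scaler0.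
  exists g => k u v; have [E|ki] := altP (k =P i); last by move=> _; apply: simple_off.
  subst k; rewrite gi !flE => /eqP.
  rewrite -subr_eq0 -scalerBl scaler_eq0 (negPf nm) orbF subr_eq0 => /eqP.
  exact: simple_eq.
have : f i (const_mx 1) = 0.
  apply: outI => j; apply: out_map_uniq => ij e.
  by rewrite -mhom_act /= zero_lfunE raddf0 ev0.
rewrite -(raddf0 (f i)) => /fI/matrixP/(_ 0 (simple_index i)); rewrite !mxE => /eqP.
by rewrite oner_eq0.
Qed.

End Modules.

(** * Homomorphisms in terms of in-maps and out-maps *)
Section Linked.
Variables (n : nat) (C : cartan n) (k0 : fieldType) (KL : splittingFieldType k0).
Variable P : preproj_datum C KL.
Implicit Types (i j : 'I_n) (M N : pmodule P).

Lemma mhom_pact M N (f : mhom M N) j i (t : tensor j (car M i)) :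
  f j (pact M j i t) = pact N j i (tmap (f i) t).
Proof.
elim/tensor_ind: t => [|t u IHt IHu|e x]; first by rewrite !raddf0.
  by rewrite !raddfD /= IHt IHu.
by rewrite mhom_act tmap_tens.
Qed.

Lemma mhom_in M N (f : mhom M N) i (t : Mdel i M) :
  f i (in_map t) = in_map (fun j => tmap (f j) (t j)).
Proof.
rewrite raddf_sum; apply: eq_bigr => j ji.
by rewrite raddfMz /= mhom_pact.
Qed.

Lemma mhom_out M N (f : mhom M N) i (m : car M i) j :
  out_map (f i m) j = tmap (f j) (out_map m j).
Proof. by apply: out_map_uniq => ij e; rewrite ev_tmap // ev_out // mhom_act. Qed.

Lemma out_in_ext M i (t u : Mdel i M) j :
  (forall k, k != i -> t k = u k) -> out_map (in_map t) j = out_map (in_map u) j.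
Proof. by move=> tu; rewrite (in_map_ext tu). Qed.

Lemma in_map_single M i j (t : tensor i (car M j)) : j != i ->
  in_map (dfwith (fun k => 0 : tensor i (car M k)) t) = pact M i j t *~ vsgn P i j.
Proof.
move=> ji; rewrite /in_map (bigD1 j) //= dfwith_in big1 ?addr0 // => k /andP[ki kj].
by rewrite dfwith_out 1?eq_sym // raddf0 mul0rz.
Qed.

(** At the vertex i, being a homomorphism means commuting with the in-maps and the
    out-maps: a single arrow into i is the in-map on one summand, up to a
    sign, and an arrow out of i is the out-map followed by the pairing. *)
Lemma make_hom M N i (F : forall k, 'Hom(car M k, car N k)) :
    (forall k l, k != i -> l != i -> forall (e : Ebim P l k) (x : car M k),
      F l (pact M l k (tens e x)) = pact N l k (tens e (F k x))) ->
    (forall t : Mdel i M, F i (in_map t) = in_map (fun j => tmap (F j) (t j))) ->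
    (forall m j, out_map (F i m) j = tmap (F j) (out_map m j)) ->
  exists g : mhom M N, forall k, g k = F k.
Proof.
move=> Foff Fin Fout.
have Fact l k (e : Ebim P l k) (x : car M k) :
    F l (pact M l k (tens e x)) = pact N l k (tens e (F k x)).
  have [E|kl] := altP (k =P l).
    by rewrite (tensor_loop (tens e x) 0) // (tensor_loop (tens e _) 0) // !raddf0.
  have [E|ki] := altP (k =P i).
    by subst k; rewrite -!ev_out // Fout ev_tmap.
  have [E|li] := altP (l =P i); last exact: Foff.
  subst l; have := Fin (dfwith (fun j => 0 : tensor i (car M j)) (tens e x)).
  rewrite in_map_single // raddfMz /= => E.
  have E1 : F i (pact M i k (tens e x)) *~ vsgn P i k
      = pact N i k (tens e (F k x)) *~ vsgn P i k.
    rewrite [LHS]E -in_map_single //; apply: in_map_ext => j ji.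
    have [Ek|jk] := altP (k =P j); last by rewrite !dfwith_out // raddf0.
    by subst j; rewrite !dfwith_in tmap_tens.
  have sgnK (Y : zmodType) (y : Y) : y *~ vsgn P i k *~ vsgn P i k = y.
    by rewrite -mulrzA sgn_sq 1?eq_sym.
  by rewrite -[LHS]sgnK E1 sgnK.
by exists (MHom Fact).
Qed.

Lemma mhom_id_subproof M j i (e : Ebim P j i) (m : car M i) :
  (\1%VF : 'Hom(car M j, car M j)) (pact M j i (tens e m)) =
  pact M j i (tens e ((\1%VF : 'Hom(car M i, car M i)) m)).
Proof. by rewrite !id_lfunE. Qed.
Definition mhom_id M : mhom M M := MHom (@mhom_id_subproof M).

Lemma mhom_comp_subproof M N Q (g : mhom N Q) (f : mhom M N) j i (e : Ebim P j i)
    (m : car M i) :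
  (g j \o f j)%VF (pact M j i (tens e m)) = pact Q j i (tens e ((g i \o f i)%VF m)).
Proof. by rewrite !comp_lfunE !mhom_act. Qed.
Definition mhom_comp M N Q (g : mhom N Q) (f : mhom M N) : mhom M Q :=
  MHom (mhom_comp_subproof g f).

Lemma mhom_zero_subproof M N j i (e : Ebim P j i) (m : car M i) :
  (0 : 'Hom(car M j, car N j)) (pact M j i (tens e m)) =
  pact N j i (tens e ((0 : 'Hom(car M i, car N i)) m)).
Proof.
by rewrite !zero_lfunE tens0 raddf0.
Qed.
Definition mhom_zero M N : mhom M N := MHom (@mhom_zero_subproof M N).

Lemma mhom_eq0P M N (f : mhom M N) :
  (forall k x, f k x = 0) \/ (exists k x, f k x != 0).
Proof.
have [/forallP f0|] := boolP [forall k, f k == 0].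
  by left=> k x; rewrite (eqP (f0 k)) zero_lfunE.
rewrite negb_forall => /existsP[k /lfunPn[x fx]]; right; exists k, x.
by rewrite zero_lfunE in fx.
Qed.

Lemma pmodule_neq0 M :
  (exists k (m : car M k), m != 0) <-> (exists k, \dim {:car M k} != 0%N).
Proof.
split=> [[k [m m0]]|[k d0]]; exists k.
  by rewrite dimv_eq0; apply: contraNneq m0 => E; rewrite -memv0 -E memvf.
by exists (vpick {:car M k}); rewrite vpick0 -dimv_eq0.
Qed.

(** * The symmetric relation behind both reflections *)
Section SameOff.
Variables (i : 'I_n) (M N : pmodule P) (th : forall k, 'Hom(car N k, car M k)).
Hypothesis thP : same_off i th.

Lemma same_off_bij k : k != i -> cancel (th k) (th k)^-1%VF /\ cancel (th k)^-1%VF (th k).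
Proof. by move=> ki; apply/lfun_bijP/(thP.1). Qed.

Lemma same_off_tmapK j (t : tensor i (car N j)) : tmap (th j)^-1%VF (tmap (th j) t) = t.
Proof.
have [E|ji] := altP (i =P j); first exact: tensor_loop.
by rewrite tmapK // => x; rewrite (same_off_bij _).1 // eq_sym.
Qed.

Lemma same_off_tmapVK j (t : tensor i (car M j)) : tmap (th j) (tmap (th j)^-1%VF t) = t.
Proof.
have [E|ji] := altP (i =P j); first exact: tensor_loop.
by rewrite tmapK // => x; rewrite (same_off_bij _).2 // eq_sym.
Qed.

Lemma same_off_inv : same_off i (fun k => (th k)^-1%VF).
Proof.
split=> [k ki|k l ki li e x].
  by have [a b] := same_off_bij ki; exists (th k).
have [_ b] := same_off_bij ki; have [c _] := same_off_bij li.
by rewrite -{1}(b x) -thP.2 // c.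
Qed.

End SameOff.

(** The second, third and fourth clauses are the exactness of
    0 -> N_i -> M_{del i} -> M_i -> 0 on the left, on the right and in the middle,
    where N_{del i} is identified with M_{del i} by th. *)
Definition reflects i M N (th : forall k, 'Hom(car N k, car M k)) : Prop :=
  [/\ same_off i th,
      (forall x : car N i, (forall j, out_map x j = 0) -> x = 0),
      (forall m : car M i, exists t, in_map t = m),
      (forall t : Mdel i M, in_map t = 0 <->
         exists x : car N i, forall j, t j = tmap (th j) (out_map x j)) &
      (forall (t : Mdel i N) j, tmap (th j) (out_map (in_map t) j)
         = out_map (in_map (fun k => tmap (th k) (t k))) j)].

Definition linked i M N :=
  exists th : forall k, 'Hom(car N k, car M k), reflects i th.

Lemma linked_plus i M N : NoQuot i M /\ is_Sigma_plus i M N <-> linked i M N.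
Proof.
split=> [[/NoQuotP ons [th [iota [thP iotaI ker outE inE]]]]|[th [thP outI ons ker oi]]].
  exists th; split=> //.
  - move=> x x0; apply: iotaI => j; rewrite -outE /Mdel_map x0 raddf0 //.
  - move=> t; rewrite ker; split=> -[x tx]; exists x => j; by rewrite tx -outE.
  - by move=> t j; rewrite -/(Mdel_map th _ j) outE inE.
split; first exact/NoQuotP.
exists th, (fun j => (linfun (tmap (th j)) \o outH N i j)%VF).
have iE x j : (linfun (@tmap _ _ _ _ P i j _ _ (th j)) \o outH N i j)%VF x = tmap (th j) (out_map x j).
  by rewrite comp_lfunE lfunE outHE.
split=> //.
- move=> x x0; apply: outI => j; have := x0 j; rewrite iE => E.
  by rewrite -[LHS](same_off_tmapK thP) E raddf0.
- by move=> t; rewrite ker; split=> -[x tx]; exists x => j; rewrite tx iE.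
- by move=> x j; rewrite iE.
- by move=> t j; rewrite iE oi.
Qed.

(** Sigma_i^- identifies the modules in the other direction, so the isomorphisms
    away from i have to be inverted; the quotient map pi onto N_i is recovered from
    the in-map of N, the signs included. *)
Lemma linked_minus i M N : NoSub i M /\ is_Sigma_minus i M N <-> linked i N M.
Proof.
split=> [[/NoSubP outI [th [pi_]]]|[th [thP outI ons ker oi]]].
  set pi := fun t : Mdel i M => _; move=> [thP ons ker inE outE].
  have piE t u : (forall j, t j = u j) -> pi t = pi u.
    by move=> tu; apply: eq_bigr => j _; rewrite tu.
  have inV (t : Mdel i M) : in_map (fun j => tmap (th j)^-1%VF (t j)) = pi t.
    by rewrite inE; apply: piE => j; rewrite /Mdel_map same_off_tmapVK.
  exists (fun k => (th k)^-1%VF); split=> //; first exact: same_off_inv.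
  - by move=> x; have [t <-] := ons x; exists (fun j => tmap (th j)^-1%VF (t j)).
  - move=> t; rewrite inE ker; split=> -[m E]; exists m => j.
      by rewrite -E /Mdel_map same_off_tmapK.
    by rewrite /Mdel_map E same_off_tmapVK.
  - by move=> t j; rewrite inV -outE /Mdel_map same_off_tmapK.
split; first exact/NoSubP.
have th'P := same_off_inv thP.
pose pi_ j := ((vsgn P i j)%:~R *: (pact N i j \o linfun (tmap (th j))))%VF.
have piE (t : Mdel i M) : \sum_j pi_ j (t j) = in_map (fun j => tmap (th j) (t j)).
  rewrite (bigD1 i) //= (tensor_loop (t i) 0) // raddf0 add0r.
  apply: eq_bigr => j ji; rewrite scale_lfunE comp_lfunE lfunE scaler_int //.
have thVK (t : Mdel i N) : in_map (fun k => tmap (th k) (tmap (th k)^-1%VF (t k))) = in_map t.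
  by apply: in_map_ext => j ji; rewrite same_off_tmapVK.
exists (fun k => (th k)^-1%VF), pi_; split=> //.
- move=> x; have [t tx] := ons x.
  by exists (fun j => tmap (th j)^-1%VF (t j)); rewrite piE thVK.
- move=> t; rewrite piE ker; split=> -[m E]; exists m => j.
    by rewrite -[LHS](same_off_tmapK thP) E (same_off_tmapK thP).
  by rewrite E.
- by move=> t; rewrite piE thVK.
- by move=> t j; rewrite piE /Mdel_map -oi (same_off_tmapK thP).
Qed.

(** * Reflections preserve bricks and reflect dimensions *)
Section Reflects.
Variables (i : 'I_n) (M N : pmodule P) (th : forall k, 'Hom(car N k, car M k)).
Hypothesis thR : reflects i th.
Let thP : same_off i th. Proof. by case: thR. Qed.
Let outI (x : car N i) : (forall j, out_map x j = 0) -> x = 0. Proof. by case: thR => _ + _ _ _; apply. Qed.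
Let ons (m : car M i) : exists t, in_map t = m. Proof. by case: thR => _ _ + _ _; apply. Qed.
Let ker (t : Mdel i M) : in_map t = 0 <->
  exists x : car N i, forall j, t j = tmap (th j) (out_map x j).
Proof. by case: thR => _ _ _ + _; apply. Qed.
Let oi (t : Mdel i N) j :
  tmap (th j) (out_map (in_map t) j) = out_map (in_map (fun k => tmap (th k) (t k))) j.
Proof. by case: thR => _ _ _ _; apply. Qed.

Local Notation D := (dsum (fun j => tensor i (car M j))).

Definition ker_emb : 'Hom(car N i, D) :=
  linfun (fun x => dpack (fun j => (linfun (tmap (th j)) \o outH N i j)%VF x)).

Lemma dproj_ker_emb x j : dproj j (ker_emb x) = tmap (th j) (out_map x j).
Proof.
by rewrite linfunE ?dprojK ?comp_lfunE ?lfunE ?outHE //; apply: dpack_linear.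
Qed.

Lemma lker_ker_emb : lker ker_emb == 0%VS.
Proof.
rewrite -subv0; apply/subvP=> x; rewrite memv_ker memv0 => /eqP x0.
apply/eqP/outI => j; rewrite -[LHS](same_off_tmapK thP) -dproj_ker_emb x0.
by rewrite !raddf0.
Qed.

Lemma limg_ker_emb : limg ker_emb = lker (inD M i).
Proof.
apply/vspaceP=> d; rewrite memv_ker inDE; apply/memv_imgP/eqP=> [[x _ ->]|].
  by apply/ker; exists x => j; rewrite dproj_ker_emb.
move/ker=> [x dx]; exists x; rewrite ?memvf //.
by apply: dsum_eq => j; rewrite dx dproj_ker_emb.
Qed.

Lemma inD_onto m : exists d, inD M i d = m.
Proof. by have [t <-] := ons m; exists (dpack t); rewrite inD_pack. Qed.

Lemma reflects_dim_off k : k != i -> \dim {:car N k} = \dim {:car M k}.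
Proof. by move=> ki; apply: lfun_bij_dim (thP.1 k ki). Qed.

Lemma reflects_dim :
  (\dim {:car N i})%:Z + (\dim {:car M i})%:Z =
  - \sum_(j | j != i) cA C i j * (\dim {:car M j})%:Z.
Proof.
have -> : \dim {:car M i} = \dim (limg (inD M i)).
  congr (\dim _); apply/vspaceP=> m; rewrite memvf; apply/esym/memv_imgP.
  by have [d <-] := inD_onto m; exists d; rewrite ?memvf.
have -> : \dim {:car N i} = \dim (lker (inD M i)).
  by rewrite -limg_ker_emb limg_dim_eq // (eqP lker_ker_emb) capv0.
rewrite -PoszD -[lker _]capfv limg_ker_dim dim_dsum (bigD1 i) //=.
have -> : \dim {:tensor i (car M i)} = 0%N.
  apply/eqP; rewrite dimv_eq0 -vpick0; apply/eqP; exact: tensor_loop.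
rewrite add0n -sumrN (big_morph Posz PoszD (erefl _)); apply: eq_bigr => j ji.
by rewrite dim_tensor // mulNr.
Qed.

(** M_i is the cokernel of N_i -> M_{del i}, and the components of f preserve the
    image of N_i by naturality of the out-map; so they induce a map on M_i.  It
    commutes with the out-map because out o in is the same for M and N. *)
Lemma reflects_extend_in (f : mhom N N) :
  exists g : mhom M M, forall k, k != i -> forall x, g k (th k x) = th k (f k x).
Proof.
pose h k := (th k \o f k \o (th k)^-1)%VF.
have hE k x : k != i -> h k (th k x) = th k (f k x).
  by move=> ki; rewrite !comp_lfunE (same_off_bij thP ki).1.
have hT j (t : tensor i (car N j)) : tmap (h j) (tmap (th j) t) = tmap (th j) (tmap (f j) t).
  have [E|ij] := altP (i =P j); first exact: tensor_loop.
  by rewrite !tmap_comp; apply: eq_tmap => x; rewrite 2!comp_lfunE hE // eq_sym.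
pose Del : 'Hom(D, D) :=
  linfun (fun d => dpack (fun j => (linfun (tmap (h j)) \o linfun (dproj j))%VF d)).
have DelE d j : dproj j (Del d) = tmap (h j) (dproj j d).
  by rewrite linfunE ?dprojK ?comp_lfunE ?lfunE //; apply: dpack_linear.
(* The pseudo-inverse of the in-map is a section of it; by exactness
   the choice of the section does not matter. *)
pose G := (inD M i \o Del \o (inD M i)^-1)%VF.
have GE (t : Mdel i M) : G (in_map t) = in_map (fun j => tmap (h j) (t j)).
  rewrite -!inD_pack !comp_lfunE; set s := ((inD M i)^-1)%VF _.
  have : s - dpack t \in lker (inD M i).
    by rewrite memv_ker raddfB /= lfun_section ?subrr //; apply: inD_onto.
  rewrite -limg_ker_emb => /memv_imgP[x _ /eqP]; rewrite subr_eq => /eqP ->.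
  rewrite raddfD raddfD /= -[RHS]add0r; congr (_ + _); last first.
    by congr (inD _ _ _); apply: dsum_eq => j; rewrite DelE !dprojK.
  rewrite inDE; apply/ker; exists (f i x) => j.
  by rewrite DelE dproj_ker_emb hT mhom_out.
pose F := dfwith h G.
have Fi : F i = G by rewrite /F dfwith_in.
have Fk k : k != i -> F k = h k by move=> ki; rewrite /F dfwith_out 1?eq_sym.
have FT j (t : tensor i (car M j)) : tmap (F j) t = tmap (h j) t.
  have [E|ij] := altP (i =P j); first exact: tensor_loop.
  by rewrite Fk // eq_sym.
have [|||g gF] := @make_hom M M i F.
- move=> k l ki li e x; rewrite !Fk //.
  have [_ Kth] := same_off_bij thP ki; rewrite -(Kth x) -thP.2 // !hE //.
  by rewrite mhom_act thP.2.
- by move=> t; rewrite Fi GE; apply: in_map_ext => j _; rewrite FT.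
- move=> m j; rewrite FT Fi; have [t <-] := ons m; rewrite GE.
  pose u k := tmap (th k)^-1%VF (t k).
  have tu k : t k = tmap (th k) (u k) by rewrite (same_off_tmapVK thP).
  have -> : in_map t = in_map (fun k => tmap (th k) (u k)).
    by apply: in_map_ext => k _; rewrite tu.
  rewrite -oi hT -mhom_out mhom_in oi.
  by apply: out_in_ext; move=> k _; rewrite tu hT.
by exists g => k ki x; rewrite gF Fk // hE.
Qed.

(** Dually, N_i is the kernel of M_{del i} -> M_i, which the components of g
    preserve by naturality of the in-map. *)
Lemma reflects_extend_out (g : mhom M M) :
  exists f : mhom N N, forall k, k != i -> forall x, g k (th k x) = th k (f k x).
Proof.
pose h k := ((th k)^-1 \o g k \o th k)%VF.
have hE k x : k != i -> th k (h k x) = g k (th k x).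
  by move=> ki; rewrite !comp_lfunE (same_off_bij thP ki).2.
have hT j (t : tensor i (car N j)) : tmap (th j) (tmap (h j) t) = tmap (g j) (tmap (th j) t).
  have [E|ij] := altP (i =P j); first exact: tensor_loop.
  by rewrite !tmap_comp; apply: eq_tmap => x; rewrite 2!comp_lfunE hE // eq_sym.
pose Del : 'Hom(D, D) :=
  linfun (fun d => dpack (fun j => (linfun (tmap (g j)) \o linfun (dproj j))%VF d)).
have DelE d j : dproj j (Del d) = tmap (g j) (dproj j d).
  by rewrite linfunE ?dprojK ?comp_lfunE ?lfunE //; apply: dpack_linear.
pose G := (ker_emb^-1 \o Del \o ker_emb)%VF.
have GE x j : tmap (th j) (out_map (G x) j) = tmap (g j) (tmap (th j) (out_map x j)).
  rewrite -!dproj_ker_emb -DelE; congr (dproj j _).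
  rewrite !comp_lfunE limg_lfunVK // limg_ker_emb memv_ker inDE.
  have -> : in_map (fun j => dproj j (Del (ker_emb x)))
          = in_map (fun j => tmap (g j) (tmap (th j) (out_map x j))).
    by apply: in_map_ext => k _; rewrite DelE dproj_ker_emb.
  rewrite -mhom_in; have -> : in_map (fun j => tmap (th j) (out_map x j)) = 0.
    by apply/ker; exists x.
  by rewrite raddf0.
pose F := dfwith h G.
have Fi : F i = G by rewrite /F dfwith_in.
have Fk k : k != i -> F k = h k by move=> ki; rewrite /F dfwith_out 1?eq_sym.
have FT j (t : tensor i (car N j)) : tmap (F j) t = tmap (h j) t.
  have [E|ij] := altP (i =P j); first exact: tensor_loop.
  by rewrite Fk // eq_sym.
have [|||f fF] := @make_hom N N i F.
- move=> k l ki li e x; rewrite !Fk //; apply: (bij_inj (thP.1 l li)).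
  by rewrite hE // thP.2 // mhom_act -hE // thP.2.
- move=> t; rewrite Fi; apply/eqP; rewrite -subr_eq0; apply/eqP/outI => j.
  rewrite -outHE raddfB /= !outHE -[LHS](same_off_tmapK thP) raddfB /=.
  rewrite GE oi -mhom_out mhom_in oi.
  set a := in_map _; set b := in_map _; suff -> : a = b by rewrite subrr raddf0.
  by apply: in_map_ext => k _; rewrite FT hT.
- move=> m j; rewrite FT Fi -[LHS](same_off_tmapK thP) GE -hT.
  by rewrite (same_off_tmapK thP).
by exists f => k ki x; rewrite fF Fk // hE.
Qed.

Lemma hom_ext_in (g g' : mhom M M) :
  (forall k, k != i -> g k =1 g' k) -> forall k, g k =1 g' k.
Proof.
move=> gg k; have [E|] := altP (k =P i); last exact: gg.
subst k => m; have [t <-] := ons m; rewrite !mhom_in; apply: in_map_ext => j ji.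
by apply: eq_tmap; apply: gg.
Qed.

Lemma hom_ext_out (f f' : mhom N N) :
  (forall k, k != i -> f k =1 f' k) -> forall k, f k =1 f' k.
Proof.
move=> ff k; have [E|] := altP (k =P i); last exact: ff.
subst k => x; apply/eqP; rewrite -subr_eq0; apply/eqP/outI => j.
rewrite -outHE raddfB /= !outHE !mhom_out.
have [E|ij] := altP (i =P j); first exact: tensor_loop.
by rewrite (eq_tmap (g := f' j)) ?subrr //; apply: ff; rewrite eq_sym.
Qed.

(** If all spaces away from i vanish, then so does M_{del i}, hence M_i and N_i. *)
Lemma reflects_neq0 : (exists k, \dim {:car M k} != 0%N) <-> (exists k, \dim {:car N k} != 0%N).
Proof.
have sum0 : (forall k, k != i -> \dim {:car M k} = 0%N) ->
    \dim {:car N i} = 0%N /\ \dim {:car M i} = 0%N.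
  move=> M0; have := reflects_dim; rewrite big1 => [|j ji]; last by rewrite M0 ?mulr0.
  by rewrite oppr0 -PoszD => -[] /eqP; rewrite addn_eq0 => /andP[/eqP ? /eqP].
have off : (exists2 k, k != i & \dim {:car M k} != 0%N) \/
    (forall k, k != i -> \dim {:car M k} = 0%N).
  have [/existsP[k /andP[ki kd]]|] := boolP [exists k, (k != i) && (\dim {:car M k} != 0%N)].
    by left; exists k.
  rewrite negb_exists => /forallP a; right=> k ki; move: (a k); rewrite ki negbK.
  by move/eqP.
case: off => [[k ki kd]|off].
  by split=> _; exists k; rewrite ?reflects_dim_off.
have [N0 M0] := sum0 off.
split=> -[k]; have [E|ki] := altP (k =P i).
- by subst k; rewrite M0.
- by rewrite off.
- by subst k; rewrite N0.
- by rewrite reflects_dim_off // off.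
Qed.

(** Extend an endomorphism to the other module, invert it there, extend the inverse
    back; the products are the identity away from i, hence everywhere. *)
Lemma reflects_brick : brick M <-> brick N.
Proof.
split=> -[nz inv]; split.
- exact/pmodule_neq0/reflects_neq0/pmodule_neq0.
- move=> f [l [x fx]]; have [g gf] := reflects_extend_in f.
  have [g0|/inv[g' g'K]] := mhom_eq0P g.
    case/eqP: fx; rewrite (hom_ext_out (f' := mhom_zero N N)) ?zero_lfunE // => k ki y.
    by apply: (bij_inj (thP.1 k ki)); rewrite -gf // g0 zero_lfunE raddf0.
  have [f' gf'] := reflects_extend_out g'.
  have fK : forall k, mhom_comp f' f k =1 mhom_id N k.
    apply: hom_ext_out => k ki y; apply: (bij_inj (thP.1 k ki)).
    by rewrite comp_lfunE id_lfunE -gf' // -gf // (g'K k).1.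
  have Kf : forall k, mhom_comp f f' k =1 mhom_id N k.
    apply: hom_ext_out => k ki y; apply: (bij_inj (thP.1 k ki)).
    by rewrite comp_lfunE id_lfunE -gf // -gf' // (g'K k).2.
  exists f' => k; split=> y; [have := fK k y|have := Kf k y];
    by rewrite /= comp_lfunE id_lfunE.
- exact/pmodule_neq0/reflects_neq0/pmodule_neq0.
- move=> g [l [x gx]]; have [f gf] := reflects_extend_out g.
  have [f0|/inv[f' f'K]] := mhom_eq0P f.
    case/eqP: gx; rewrite (hom_ext_in (g' := mhom_zero M M)) ?zero_lfunE // => k ki y.
    by have [_ Kth] := same_off_bij thP ki; rewrite -(Kth y) gf // f0 zero_lfunE raddf0.
  have [g' gf'] := reflects_extend_in f'.
  have gK : forall k, mhom_comp g' g k =1 mhom_id M k.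
    apply: hom_ext_in => k ki y; have [_ Kth] := same_off_bij thP ki.
    by rewrite -(Kth y) comp_lfunE id_lfunE gf // gf' // (f'K k).1.
  have Kg : forall k, mhom_comp g g' k =1 mhom_id M k.
    apply: hom_ext_in => k ki y; have [_ Kth] := same_off_bij thP ki.
    by rewrite -(Kth y) comp_lfunE id_lfunE gf' // gf // (f'K k).2.
  exists g' => k; split=> y; [have := gK k y|have := Kg k y];
    by rewrite /= comp_lfunE id_lfunE.
Qed.

End Reflects.
End Linked.

(** * Existence of reflections *)
Lemma cokernel (K : fieldType) (U V : vectType K) (f : 'Hom(U, V)) :
  exists (Q : vectType K) (p : 'Hom(V, Q)),
    (forall q, exists v, p v = q) /\ (forall v, p v = 0 <-> exists u, v = f u).
Proof.
pose g := (\1 - projv (limg f))%VF.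
have gE v : g v = v - projv (limg f) v by rewrite add_lfunE opp_lfunE id_lfunE.
have pE v : (linfun (vsproj (limg g)) \o g)%VF v = vsproj (limg g) (g v).
  by rewrite comp_lfunE lfunE.
exists (subvs_of (limg g)), (linfun (vsproj (limg g)) \o g)%VF; split=> [q|v].
  have /memv_imgP[v _ vq] := subvsP q; exists v.
  by rewrite pE -vq vsvalK.
rewrite pE; split=> [v0|[u ->]].
  have : g v = 0.
    by rewrite -[LHS](vsprojK (U := limg g)) ?v0 ?raddf0 // memv_img ?memvf.
  rewrite gE => /eqP; rewrite subr_eq0 => /eqP vE.
  have /memv_imgP[u _ uE] : projv (limg f) v \in limg f by apply: memv_proj.
  by exists u; rewrite -uE.
by rewrite gE projv_id ?subrr ?raddf0 // memv_img ?memvf.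
Qed.

Section Existence.
Variables (n : nat) (C : cartan n) (k0 : fieldType) (KL : splittingFieldType k0).
Variable P : preproj_datum C KL.
Implicit Types (i j : 'I_n) (M N : pmodule P).

(** Putting Q at the vertex i gives a space of type X' i that is equal to Q only
    up to a transport, hence the isomorphism phi. *)
Lemma replace_space (X : forall k, vectType (Kv P k)) i (Q : vectType (Kv P i)) :
  exists (X' : forall k, vectType (Kv P k)) (th : forall k, 'Hom(X' k, X k))
         (phi : 'Hom(X' i, Q)),
    bijective phi /\ (forall k, k != i -> bijective (th k)).
Proof.
pose X' := dfwith X Q.
have X'i : X' i = Q by rewrite /X' dfwith_in.
have X'k k : k != i -> X' k = X k by move=> ki; rewrite /X' dfwith_out 1?eq_sym.
have iso k (U V : vectType (Kv P k)) : U = V -> exists f : 'Hom(U, V), bijective f.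
  by move=> ->; exists \1%VF, id => x; rewrite id_lfunE.
have [phi phiP] := iso i _ _ X'i.
have ex k : exists f : 'Hom(X' k, X k), k != i -> bijective f.
  have [_|/X'k/iso[f fP]] := altP (k =P i); first by exists 0.
  by exists f.
have [th thP] := fin_all_exists ex.
by exists X', th, phi.
Qed.

Section Glue.
Variables (M : pmodule P) (i : 'I_n) (Q : vectType (Kv P i)).
Variables (inn : forall j, 'Hom(tensor i (car M j), Q)).
Variables (ou : forall j, 'Hom(Q, tensor i (car M j))).
Hypothesis inn_ou : forall x, \sum_(j | j != i) inn j (ou j x) = 0.
Hypothesis ou_inn : forall j l t, j != i ->
  ou l (inn j t) = out_map (pact M i j t) l *~ vsgn P i j.

(** A module with a new space Q at i needs only an in-map and an out-map for Q,
    with inn o ou = 0 and ou o inn = out o in.  The first equation is the relation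
    at i.  The second gives the relations elsewhere: in the relation at l, the paths
    through i occur only through the composite ou o inn, so they act as in M.
    Here inn carries the signs of the in-map. *)
Lemma glue : exists N (th : forall k, 'Hom(car N k, car M k)) (phi : 'Hom(car N i, Q)),
  [/\ same_off i th, bijective phi,
      forall t : Mdel i N, phi (in_map t) = \sum_(j | j != i) inn j (tmap (th j) (t j)) &
      forall (x : car N i) j, tmap (th j) (out_map x j) = ou j (phi x)].
Proof.
have [X [th [phi [phib thb]]]] := replace_space (car M) Q.
have [phiK Kphi] := lfun_bijP phib.
have thK k : k != i -> cancel (th k) (th k)^-1%VF by move=> /thb/lfun_bijP[].
have Kth k : k != i -> cancel (th k)^-1%VF (th k) by move=> /thb/lfun_bijP[].
pose A k : 'Hom(tensor i (X k), X i) :=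
  ((vsgn P i k)%:~R *: (phi^-1 \o inn k \o linfun (tmap (th k))))%VF.
pose Cf l k : 'Hom(tensor l (X k), X l) :=
  ((th l)^-1 \o pact M l k \o linfun (tmap (th k)))%VF.
pose b l (e : Ebim P l i) (x : X i) := ev e (ou l (phi x)).
pose B l : 'Hom(tensor l (X i), X l) := ((th l)^-1 \o linfun (tlift (b l)))%VF.
have bE l e x : i != l -> linfun (tlift (b l)) (tens e x) = b l e x.
  move=> il; have bbal : balanced (b l).
    split=> [e1 e2 y|e1 x1 x2|e1 c y]; rewrite /b.
    - by rewrite evDl.
    - by rewrite !raddfD evDr.
    - by rewrite ev_rscale // !linearZ.
  rewrite linfunE ?tlift_tens // => c t u.
  have bZ : scalable (tlift (b l)).
    by apply: tlift_scalable => d e1 y; rewrite /b evZl.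
  pose aM := GRing.isZmodMorphism.Build _ _ (tlift (b l)) (tlift_additive bbal).
  pose g : {additive tensor l (X i) -> car M l} := HB.pack (tlift (b l)) aM.
  by rewrite [LHS](raddfD g) /= bZ.
pose act l : forall k, 'Hom(tensor l (X k), X l) :=
  dfwith (fun l => dfwith (Cf l) (B l)) A l.
have act_off l k t : l != i -> k != i -> th l (act l k t) = pact M l k (tmap (th k) t).
  move=> li ki; rewrite /act dfwith_out 1?eq_sym // dfwith_out 1?eq_sym //.
  by rewrite !comp_lfunE Kth // lfunE.
have act_in k t : phi (act i k t) = inn k (tmap (th k) t) *~ vsgn P i k.
  by rewrite /act dfwith_in scale_lfunE scaler_int raddfMz /= !comp_lfunE lfunE Kphi.
have act_out l e x : l != i -> th l (act l i (tens e x)) = ev e (ou l (phi x)).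
  move=> li; rewrite /act dfwith_out 1?eq_sym // dfwith_in comp_lfunE Kth // bE //.
  by rewrite eq_sym.
have rel l (m : X l) : \sum_(j | j != l) (\sum_(a : arrow P l j) \sum_k
    act l j (tens (mono (arrow_star a) (tnth (dbas P j l) k))
      (act j l (tens (mono a (tnth (bas P j l) k)) m)))) *~ vsgn P l j = 0.
  have [E|li] := altP (l =P i).
    subst l; apply: (bij_inj phib); rewrite raddf0 raddf_sum -[RHS](inn_ou (phi m)).
    apply: eq_bigr => j ji; rewrite raddfMz /= raddf_sum.
    have -> : ou j (phi m) = adj (fun e => ev e (ou j (phi m))).
      have ij : i != j by rewrite eq_sym.
      apply: (ev_inj ij) => e; rewrite ev_adj // => c e1 e2.
      by rewrite evDl evZl.
    rewrite -[in RHS](mulr1z (inn _ _)) -(sgn_sq P (i := i) (j := j)) 1?eq_sym // mulrzA.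
    congr (_ *~ _); rewrite /adj raddf_sum mulrz_suml; apply: eq_bigr => a _.
    rewrite !raddf_sum mulrz_suml; apply: eq_bigr => k _.
    by rewrite [LHS]act_in tmap_tens act_out.
  apply: (bij_inj (thb l li)); rewrite raddf0 raddf_sum -[RHS](pact_rel (th l m)).
  apply: eq_bigr => j jl; rewrite raddfMz; congr (_ *~ _).
  rewrite raddf_sum; apply: eq_bigr => a _; rewrite raddf_sum.
  apply: eq_bigr => k _ /=.
  have [E|ji] := altP (j =P i); last by rewrite act_off // tmap_tens act_off // tmap_tens.
  subst j; rewrite act_out // act_in raddfMz /= tmap_tens ou_inn //.
  by rewrite -mulrzA sgn_sq 1?eq_sym // mulr1z ev_out // eq_sym.
pose N := PModule rel; exists N, th, phi; split=> //.
- by split=> // k l ki li e x; rewrite /= act_off // tmap_tens.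
- move=> t; rewrite /in_map raddf_sum; apply: eq_bigr => j ji.
  by rewrite raddfMz /= act_in -mulrzA sgn_sq 1?eq_sym.
move=> x j; have [E|ij] := altP (i =P j); first exact: tensor_loop.
by apply: (ev_inj ij) => e; rewrite ev_tmap // ev_out //= act_out // eq_sym.
Qed.

End Glue.

(** Glue in the kernel of the in-map, with the inclusion as out-map. *)
Lemma exists_Sigma_plus M i : NoQuot i M -> exists N, linked i M N.
Proof.
move=> /NoQuotP ons; pose Q : vectType (Kv P i) := subvs_of (lker (inD M i)).
pose ou j : 'Hom(Q, tensor i (car M j)) := (linfun (dproj j) \o linfun vsval)%VF.
have ouE j (x : Q) : ou j x = dproj j (vsval x) by rewrite comp_lfunE !lfunE.
pose inn j : 'Hom(tensor i (car M j), Q) :=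
  ((vsgn P i j)%:~R *: (linfun (vsproj (lker (inD M i))) \o outD M i \o pact M i j))%VF.
have innE j t : inn j t = vsproj _ (outD M i (pact M i j t)) *~ vsgn P i j.
  by rewrite scale_lfunE scaler_int !comp_lfunE lfunE.
have sumE (t : Mdel i M) :
    \sum_(j | j != i) inn j (t j) = vsproj (lker (inD M i)) (outD M i (in_map t)).
  rewrite !raddf_sum; apply: eq_bigr => j _.
  by rewrite innE !raddfMz.
have outK m : vsval (vsproj (lker (inD M i)) (outD M i m)) = outD M i m.
  by rewrite vsprojK // memv_ker inD_outD.
have [||N [th [phi [thP phib inE outE]]]] := @glue M i Q inn ou.
- move=> x; rewrite (sumE (fun j => ou j x)).
  have -> : in_map (fun j => ou j x) = inD M i (vsval x).
    by rewrite inDE; apply: in_map_ext => j _; rewrite ouE.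
  by have := subvsP x; rewrite memv_ker => /eqP ->; rewrite !raddf0.
- by move=> j l t ji; rewrite innE raddfMz /= ouE outK dproj_outD.
have [phiK Kphi] := lfun_bijP phib.
exists N, th; split=> //.
- move=> x x0; apply: (bij_inj phib); rewrite raddf0; apply: subvs_inj.
  by apply: dsum_eq => j; rewrite -ouE -outE x0 !raddf0.
- move=> t; split=> [t0|[x tx]].
    have dK : dpack t \in lker (inD M i) by rewrite memv_ker inD_pack t0.
    exists ((phi^-1)%VF (vsproj _ (dpack t))) => j.
    by rewrite outE Kphi ouE vsprojK // dprojK.
  have -> : in_map t = inD M i (vsval (phi x)).
    by rewrite inDE; apply: in_map_ext => j _; rewrite tx outE ouE.
  by have := subvsP (phi x); rewrite memv_ker => /eqP.
- move=> t j; rewrite outE inE.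
  by rewrite (sumE (fun k => tmap (th k) (t k))) ouE outK dproj_outD.
Qed.

(** Glue in the cokernel of the out-map, with the projection as in-map; out o in
    factors through it because in o out = 0. *)
Lemma exists_Sigma_minus M i : NoSub i M -> exists N, linked i N M.
Proof.
move=> /NoSubP outI.
have [Q [p [ponto pker]]] := cokernel (outD M i).
pose D := dsum (fun j => tensor i (car M j)).
pose inj j (t : tensor i (car M j)) : D := dpack (dfwith (fun k => 0 : tensor i (car M k)) t).
have injL j : linear (inj j).
  move=> c t u; apply: dsum_eq => k; rewrite linearP /= !dprojK.
  have [E|jk] := altP (j =P k); first by subst k; rewrite !dfwith_in.
  by rewrite !dfwith_out // scaler0 addr0.
pose inn j : 'Hom(tensor i (car M j), Q) := (p \o linfun (inj j))%VF.
have innE j t : inn j t = p (inj j t) by rewrite comp_lfunE linfunE.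
have sumE (t : Mdel i M) : \sum_(j | j != i) inn j (t j) = p (dpack t).
  under eq_bigr do rewrite innE; rewrite -raddf_sum; congr (p _).
  apply: dsum_eq => k; rewrite raddf_sum dprojK /=.
  have [E|ki] := altP (i =P k); first exact: tensor_loop.
  rewrite (bigD1 k) 1?eq_sym //= dprojK dfwith_in big1 ?addr0 // => j /andP[_ jk].
  by rewrite dprojK dfwith_out.
pose ou l : 'Hom(Q, tensor i (car M l)) :=
  (linfun (dproj l) \o outD M i \o inD M i \o p^-1)%VF.
have ouE l d : ou l (p d) = out_map (inD M i d) l.
  rewrite !comp_lfunE lfunE /= dproj_outD.
  have /pker[m /eqP] : p ((p^-1)%VF (p d) - d) = 0.
    by rewrite raddfB /= lfun_section // subrr.
  by rewrite subr_eq => /eqP ->; rewrite raddfD /= inD_outD add0r.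
have [||N [th [phi [thP phib inE outE]]]] := @glue M i Q inn ou.
- move=> x; have [d <-] := ponto x; rewrite (sumE (fun j => ou j (p d))); apply/pker.
  by exists (inD M i d); apply: dsum_eq => j; rewrite dprojK ouE dproj_outD.
- move=> j l t ji; rewrite innE ouE inD_pack in_map_single //.
  by rewrite -outHE raddfMz /= outHE.
have [phiK Kphi] := lfun_bijP phib.
have thVP := same_off_inv thP.
have in_th (t : Mdel i M) : phi (in_map (fun j => tmap (th j)^-1%VF (t j))) = p (dpack t).
  by rewrite inE -sumE; apply: eq_bigr => j _; rewrite (same_off_tmapVK thP).
exists N, (fun k => (th k)^-1%VF); split=> //.
- move=> x; have [d dx] := ponto (phi x).
  exists (fun j => tmap (th j)^-1%VF (dproj j d)); apply: (bij_inj phib).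
  by rewrite in_th dpackK.
- move=> t; have E : phi (in_map t) = p (dpack (fun j => tmap (th j) (t j))) by rewrite inE sumE.
  split=> [t0|[m tm]].
    move: E; rewrite t0 raddf0 => /esym/pker[m mE]; exists m => j.
    rewrite -[LHS](same_off_tmapK thP); congr (tmap _ _).
    by rewrite -dproj_outD -mE dprojK.
  apply: (bij_inj phib); rewrite E raddf0; apply/pker; exists m.
  by apply: dsum_eq => j; rewrite dprojK dproj_outD tm (same_off_tmapVK thP).
- move=> t j; rewrite -[RHS](same_off_tmapK thP) outE in_th ouE inD_pack.
  by [].
Qed.

(** If S_i is both a submodule, spanned by m, and a quotient, given by the linear
    form l, then x |-> l(x) m is a nonzero endomorphism.  It has rank one and is
    concentrated at i, so if it is invertible then M is a line at i. *)
Lemma brick_trichotomy M i : brick M ->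
  [\/ NoSub i M, NoQuot i M | forall k, \dim {:car M k} = (k == i)].
Proof.
move=> [nz inv].
have [ker0|] := boolP (lker (outD M i) == 0%VS).
  constructor 1; apply/NoSubP => m m0; apply: (elimT lker0P ker0).
  by rewrite raddf0; apply: dsum_eq => j; rewrite dproj_outD m0 raddf0.
rewrite -vpick0; set m := vpick _ => m0.
have outm j : out_map m j = 0.
  have := memv_pick (lker (outD M i)); rewrite memv_ker -/m => /eqP E.
  by rewrite -dproj_outD E raddf0.
have [ons|[l l0 [m1 lm1]]] := exists_functional M i.
  by constructor 2; apply/NoQuotP.
constructor 3.
pose f : 'Hom(car M i, car M i) := linfun (fun x => l x *: m).
have fE x : f x = l x *: m.
  by apply: linfunE => c u v; rewrite linearP scalerDl scalerA.
have [||g gi gk] := @hom_at_vertex _ _ _ _ P M M i f.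
- by move=> j t ij; rewrite fE l0 // scale0r.
- by move=> x j _; rewrite fE -outHE linearZ /= outHE outm scaler0.
have [|g' g'K] := inv g.
  by exists i, m1; rewrite gi fE lm1 scale1r.
move=> k; have [E|ki] := altP (k =P i); last first.
  apply/eqP; rewrite dimv_eq0 -subv0; apply/subvP=> x _.
  by rewrite memv0 -((g'K k).1 x) gk // zero_lfunE raddf0.
subst k; have g'm : g' i m != 0.
  by apply: contraNneq m0 => E; rewrite -((g'K i).2 m) E raddf0.
have -> : {:car M i}%VS = <[g' i m]>%VS.
  apply/vspaceP=> x; rewrite memvf; apply/esym/vlineP; exists (l x).
  by rewrite -{1}((g'K i).1 x) gi fE linearZ.
by rewrite dim_vline g'm.
Qed.

(** * Invariance under isomorphism *)
Lemma miso_refl M : miso M M.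
Proof. by exists (mhom_id M) => k; exists id => x; rewrite id_lfunE. Qed.

Lemma miso_inv M N (f : mhom M N) : (forall k, bijective (f k)) ->
  exists g : mhom N M, forall k, cancel (f k) (g k) /\ cancel (g k) (f k).
Proof.
move=> fb; have fV k := lfun_bijP (fb k).
have act l k (e : Ebim P l k) (x : car N k) :
    ((f l)^-1)%VF (pact N l k (tens e x)) = pact M l k (tens e (((f k)^-1)%VF x)).
  by rewrite -{1}((fV k).2 x) -mhom_act (fV l).1.
by exists (MHom act).
Qed.

Lemma miso_sym M N : miso M N -> miso N M.
Proof. by move=> [f /miso_inv[g gK]]; exists g => k; have [a b] := gK k; exists (f k). Qed.

Lemma miso_trans M N Q : miso M N -> miso N Q -> miso M Q.
Proof.
move=> [f fb] [g gb]; exists (mhom_comp g f) => k.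
by apply: (eq_bij (bij_comp (gb k) (fb k))) => x; rewrite /= comp_lfunE.
Qed.

Lemma miso_dim M N k : miso M N -> \dim {:car M k} = \dim {:car N k}.
Proof. by move=> [f fb]; apply: lfun_bij_dim (fb k). Qed.

Lemma miso_brick M N : miso M N -> brick M -> brick N.
Proof.
move=> [f fb] [[k [m m0]] inv]; have [g gK] := miso_inv fb; split.
  by exists k, (f k m); rewrite -(raddf0 (f k)) (inj_eq (bij_inj (fb k))).
move=> h [l [x hx]]; have [|h' h'K] := inv (mhom_comp g (mhom_comp h f)).
  exists l, (g l x); rewrite /= !comp_lfunE (gK l).2 -(raddf0 (g l)).
  by rewrite (can_eq (gK l).2).
exists (mhom_comp f (mhom_comp h' g)) => q; have [a b] := h'K q; have [fK gfK] := gK q.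
split=> y; rewrite /= !comp_lfunE.
  have := a (g q y); rewrite /= !comp_lfunE gfK => ->.
  by rewrite gfK.
by have := b (g q y); rewrite /= !comp_lfunE => E; rewrite -[LHS]gfK E gfK.
Qed.

Lemma linked_misol i M M' N : miso M M' -> linked i M N -> linked i M' N.
Proof.
move=> [f fb] [th [thP outI ons ker oi]]; have [g gK] := miso_inv fb.
have fT j (t : tensor i (car M j)) : tmap (g j) (tmap (f j) t) = t by apply: tmapK (gK j).1 _.
have gT j (t : tensor i (car M' j)) : tmap (f j) (tmap (g j) t) = t by apply: tmapK (gK j).2 _.
exists (fun k => f k \o th k)%VF; split=> //.
- split=> [k ki|k l ki li e x].
    apply: (eq_bij (bij_comp (fb k) (thP.1 k ki))) => x; by rewrite /= comp_lfunE.
  by rewrite !comp_lfunE thP.2 // mhom_act.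
- move=> m; have [t tm] := ons (g i m); exists (fun j => tmap (f j) (t j)).
  by rewrite -mhom_in tm (gK i).2.
- move=> t; have -> : in_map t = f i (in_map (fun j => tmap (g j) (t j))).
    by rewrite mhom_in; apply: in_map_ext => j _; rewrite gT.
  split=> [/eqP|[x tx]].
    rewrite -(raddf0 (f i)) (inj_eq (bij_inj (fb i))) => /eqP/ker[x tx]; exists x => j.
    by rewrite -tmap_comp -tx gT.
  rewrite (ker _).2 ?raddf0 //; exists x => j.
  by rewrite tx -tmap_comp fT.
- move=> t j; rewrite -tmap_comp oi -mhom_out mhom_in; apply: out_in_ext => k _.
  by rewrite tmap_comp.
Qed.

Lemma linked_misor i M N N' : miso N N' -> linked i M N -> linked i M N'.
Proof.
move=> [f fb] [th [thP outI ons ker oi]]; have [g gK] := miso_inv fb.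
exists (fun k => th k \o g k)%VF; split=> //.
- split=> [k ki|k l ki li e x].
    have gb : bijective (g k) by exists (f k); case: (gK k).
    apply: (eq_bij (bij_comp (thP.1 k ki) gb)) => x; by rewrite /= comp_lfunE.
  by rewrite !comp_lfunE mhom_act thP.2.
- move=> x x0; rewrite -((gK i).2 x) (outI (g i x)) ?raddf0 // => j.
  by rewrite mhom_out x0 raddf0.
- move=> t; rewrite ker; split=> -[x tx].
    by exists (f i x) => j; rewrite tx -tmap_comp -mhom_out (gK i).1.
  by exists (g i x) => j; rewrite tx -tmap_comp -mhom_out.
- move=> t j; rewrite -tmap_comp -mhom_out mhom_in oi; apply: out_in_ext => k _.
  by rewrite tmap_comp.
Qed.

Lemma Sigma_expr_miso w M M' N : miso M M' -> is_Sigma_expr w M N -> is_Sigma_expr w M' N.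
Proof.
case: w => [|[[] i] w] MM'; first by move=> MN; apply: miso_trans (miso_sym MM') MN.
  by move=> [Q [/linked_plus L E]]; exists Q; split=> //; apply/linked_plus/linked_misol/L.
by move=> [Q [/linked_minus L E]]; exists Q; split=> //; apply/linked_minus/linked_misor/L.
Qed.

End Existence.

(** * Dimension vectors and the induction along the expression *)
Section Main.
Variables (R : realType) (n : nat) (C : cartan n).
Implicit Types (i j : 'I_n) (x : 'rV[R]_n).

Lemma form_coroot i x : Defs.form C (coroot R C i) x = \sum_j (cA C i j)%:~R * x 0 j.
Proof.
have di : (cd C i)%:R != 0 :> R by rewrite pnatr_eq0 -lt0n cd_gt0.
rewrite /Defs.form (bigD1 i) //= [X in _ + X]big1 ?addr0 => [|k ki].
  by apply: eq_bigr => j _; rewrite !mxE !eqxx mulr1 mulrA mulVf // mul1r.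
by apply: big1 => j _; rewrite !mxE eqxx (negPf ki) mulr0 !mul0r.
Qed.

Lemma sref_coord i x k : sref C i x 0 k =
  if k == i then - x 0 i - \sum_(j | j != i) (cA C i j)%:~R * x 0 j else x 0 k.
Proof.
rewrite !mxE eqxx /=; case: eqP => [->|_]; last by rewrite mulr0 subr0.
by rewrite mulr1 form_coroot (bigD1 i) //= cA_diag; ring.
Qed.

Lemma srefK i : involutive (@sref R n C i).
Proof.
move=> x; apply/rowP=> k; rewrite !sref_coord eqxx; case: eqP => [->|] //.
set a := \sum_(j | _) _; set b := \sum_(j | _) _; suff -> : a = b by ring.
by apply: eq_bigr => j ji; rewrite sref_coord (negPf ji).
Qed.

Variables (k0 : fieldType) (KL : splittingFieldType k0).
Variable P : preproj_datum C KL.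
Implicit Types M N : pmodule P.

Lemma dimvecE M k : dimvec R M 0 k = (\dim {:car M k})%:R.
Proof.
rewrite summxE (bigD1 k) //= !mxE !eqxx mulr1 big1 ?addr0 // => j jk.
by rewrite !mxE [_ == j]eq_sym (negPf jk) andbF mulr0.
Qed.

(** The coordinate at i is the dimension count in the exact sequence: the space
    M_{del i} has dimension - sum_(j <> i) A_ij dim M_j. *)
Lemma linked_dimvec i M N : linked i M N -> dimvec R N = sref C i (dimvec R M).
Proof.
move=> [th thR]; apply/rowP=> k; rewrite sref_coord !dimvecE.
have [E|ki] := altP (k =P i); last by rewrite (reflects_dim_off thR).
subst k; have := congr1 (fun z : int => z%:~R : R) (reflects_dim thR).
rewrite rmorphD rmorphN rmorph_sum /= -!pmulrn => E.
apply: (addIr (\dim {:car M i})%:R); rewrite [LHS]E addrAC addNr add0r; congr (- _).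
by apply: eq_bigr => j _; rewrite rmorphM /= dimvecE.
Qed.

Lemma simple_brick j : brick (simple_mod P j).
Proof.
pose one : car (simple_mod P j) j := const_mx 1.
have oneE : one 0 (simple_index j) = 1 by rewrite mxE.
have sc (v : car (simple_mod P j) j) : v = v 0 (simple_index j) *: one.
  by apply: simple_eq; rewrite !mxE mulr1.
split.
  exists j, one; apply/eqP=> /matrixP/(_ 0 (simple_index j)).
  by rewrite oneE mxE; apply/eqP/oner_neq0.
move=> f [k [m fm]]; have [E|kj] := altP (k =P j); last first.
  by case/eqP: fm; apply: simple_off.
subst k; pose c := f j one 0 (simple_index j).
have fE v : f j v = c *: v.
  by rewrite [in LHS](sc v) linearZ /= (sc (f j one)) -/c {2}(sc v) !scalerA mulrC.
have c0 : c != 0 by apply: contraNneq fm => E; rewrite fE E scale0r.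
have [||g gj _] := @hom_at_vertex _ _ _ _ P (simple_mod P j) (simple_mod P j) j (c^-1 *: \1%VF).
- by move=> k t _; rewrite /= zero_lfunE raddf0.
- move=> v k jk; by apply: out_map_uniq => _ e /=; rewrite zero_lfunE ev0.
exists g => k; have [E|kj] := altP (k =P j); last by split=> v; apply: simple_off.
subst k; split=> v; rewrite gj fE scale_lfunE id_lfunE scalerA ?mulVf ?mulfV // scale1r //.
Qed.

Lemma simple_dimvec j : dimvec R (simple_mod P j) = alpha R j.
Proof.
by apply/rowP=> k; rewrite dimvecE !mxE eqxx dimvf /dim /= mul1n.
Qed.

(** All spaces of M but the line at j vanish, so a nonzero linear form on
    that line is an isomorphism to S_j. *)
Lemma miso_simple M j : dimvec R M = alpha R j -> miso M (simple_mod P j).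
Proof.
move=> Mj; have dM k : \dim {:car M k} = (k == j).
  have := congr1 (fun v : 'rV_n => v 0 k) Mj; rewrite dimvecE mxE eqxx /=.
  by move/eqP; rewrite eqr_nat => /eqP.
have M0 k (x y : car M k) : k != j -> x = y.
  move=> kj; have /eqP := dM k; rewrite (negPf kj) dimv_eq0 => /eqP V0.
  by have := memvf x; have := memvf y; rewrite V0 !memv0 => /eqP -> /eqP ->.
have j0 : (0 < \dim {:car M j})%N by rewrite dM eqxx.
pose q := Ordinal j0; pose b := (vbasis {:car M j})`_q.
pose l := coord (vbasis {:car M j}) q.
have lb : l b = 1.
  by rewrite /l /b coord_free ?eqxx //; apply: basis_free (vbasisP _).
have lE (x : car M j) : x = l x *: b.
  rewrite {1}(coord_vbasis (memvf x)) (bigD1 q) //= big1 ?addr0 // => p pq.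
  case/eqP: pq; apply: val_inj => /=; have := ltn_ord p.
  by rewrite {2}dM eqxx; case: (nat_of_ord p).
pose fl : 'Hom(car M j, car (simple_mod P j) j) := linfun (fun m => const_mx (l m)).
have flE m : fl m = const_mx (l m).
  by apply: linfunE => c u v; apply/matrixP=> a d; rewrite !mxE /l linearP.
have [||g gj _] := @hom_at_vertex _ _ _ _ P M (simple_mod P j) j fl.
- move=> k t jk; suff -> : t = 0 by rewrite !raddf0.
  elim/tensor_ind: t => [|t u -> ->|e x] //; first by rewrite addr0.
  by rewrite (M0 k x 0) 1?eq_sym // tens0.
- move=> m k jk; by apply: out_map_uniq => _ e /=; rewrite zero_lfunE ev0.
exists g => k; have [E|kj] := altP (k =P j); last first.
  by exists (fun=> 0) => v; [apply: M0 | apply: simple_off].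
subst k; exists (fun v : 'rV_(j == j) => v 0 (simple_index j) *: b) => v.
  by rewrite gj flE mxE -lE.
by apply: simple_eq; rewrite gj linearZ /= flE lb !mxE mulr1.
Qed.

(** The starting vector is arbitrary, so that the induction can peel off the first
    reflection to be applied; nonnegativity excludes the third case of
    [brick_trichotomy]. *)
Lemma bricks_along (s : seq 'I_n) x : (forall k, 0 <= x 0 k) ->
    increasing_along C s x -> forall B : pmodule P,
  (brick B /\ dimvec R B = reflect_along C s x) <->
  exists M, [/\ brick M, dimvec R M = x &
    exists eps : (size s).-tuple bool, is_Sigma_expr (zip eps s) M B].
Proof.
elim: s x => [|i s IHs] x x0 /=.
  move=> _ B; split=> [[Bb Bx]|[M [Mb Mx [eps]]]].
    by exists B; split=> //; exists [tuple]; apply: miso_refl.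
  rewrite (tuple0 eps) /= => MB; split; first exact: miso_brick MB Mb.
  by rewrite -Mx; apply/rowP=> k; rewrite !dimvecE (miso_dim k MB).
move=> [[c c0 xc] inc] B; rewrite IHs //; last first.
  move=> k; have -> : sref C i x = x + c *: alpha R i by rewrite -xc addrC subrK.
  by rewrite !mxE addr_ge0 // mulr_ge0 ?ler0n // ltW.
split=> [[M' [M'b M'x [eps epsB]]]|[M [Mb Mx [[[|e eps] //= epsP]]]]].
  have tail e : size (e :: eps) == size (i :: s) by rewrite /= size_tuple.
  case: (brick_trichotomy i M'b) => [/exists_Sigma_minus[M L]|/exists_Sigma_plus[M L]|dM'].
  - exists M; split.
    + by case: (L) => th /reflects_brick ->.
    + by rewrite -[LHS](srefK i) -(linked_dimvec L) M'x srefK.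
    + by exists (Tuple (tail true)), M'; split=> //; apply/linked_plus.
  - exists M; split.
    + by case: (L) => th /reflects_brick <-.
    + by rewrite (linked_dimvec L) M'x srefK.
    + by exists (Tuple (tail false)), M'; split=> //; apply/linked_minus.
  (* The brick is S_i, hence x = - alpha_i, against x >= 0. *)
  have E : sref C i x = alpha R i.
    by rewrite -M'x; apply/rowP=> k; rewrite dimvecE dM' !mxE eqxx.
  have := x0 i; rewrite -[x](srefK i) E sref_coord eqxx !mxE !eqxx.
  rewrite big1 => [|j ji]; last by rewrite !mxE eqxx (negPf ji) mulr0.
  by rewrite subr0 oppr_ge0 ler10.
move=> [M' [step expr]]; exists M'.
have [M'b M'x] : brick M' /\ dimvec R M' = sref C i x.
  case: e step {epsP} => [/linked_plus L|/linked_minus L]; case: (L) => th /reflects_brick bE.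
    by rewrite -bE (linked_dimvec L) Mx.
  by rewrite bE -Mx (linked_dimvec L) srefK.
by split=> //; exists (Tuple (epsP : size eps == size s)).
Qed.

End Main.

Theorem theorem5p1 (R : realType) (n : nat) (C : cartan n)
    (k0 : fieldType) (KL : splittingFieldType k0) (P : preproj_datum C KL)
    (beta : 'rV[R]_n) (s : seq 'I_n) (j : 'I_n) :
  positive_root C beta -> positive_expression C beta s j ->
  forall B : pmodule P,
    (brick B /\ dimvec R B = beta) <->
    (exists eps : (size s).-tuple bool,
       is_Sigma_expr (zip eps s) (simple_mod P j) B).
Proof.
move=> _ [-> inc] B; have a0 k : 0 <= alpha R j 0 k by rewrite mxE ler0n.
rewrite (bricks_along a0 inc); split=> [[M [Mb /miso_simple Mj [eps epsB]]]|[eps epsB]].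
  by exists eps; apply: Sigma_expr_miso Mj epsB.
exists (simple_mod P j); split; [exact: simple_brick | exact: simple_dimvec |].
by exists eps.
Qed.
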